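(* Let $k=\mathbb{Q}$, $\overline{k}=\mathbb{C}$ and let $L,m,t$ be natural numbers with $m>2L$. Then there exists a subset $S\subset\mathbb{R}^{mt}$ satisfying the following conditions: (i) $S$ is dense in the strong topology of $\mathbb{R}^{mt}$; (ii) any element $\gamma=(\gamma_1,\ldots,\gamma_m)\in S$ with $\gamma_1,\ldots,\gamma_m\in\mathbb{R}^t$ has the following property: let $\mathcal{O}$ be an arbitrary $\mathbb{Q}$-constructible object class of $t$-variate polynomial functions over $\mathbb{C}$ such that for $\mathcal{O}$ there exists a $\mathbb{Q}$-definable holomorphic encoding by a data structure of size $L$, and suppose that $\mathcal{O}$ is a cone. Let $\sigma:\overline{\mathcal{O}}\to\mathbb{A}^m(\mathbb{C})$ be the map defined by $\sigma(F):=(F(\gamma_1),\ldots,F(\gamma_m))$ for $F\in\overline{\mathcal{O}}$ and let $\mathcal{D}^*:=\sigma(\overline{\mathcal{O}})$. Then $\mathcal{D}^*$ is a cone of $\mathbb{A}^m(\mathbb{C})$ which is closed in the $\mathbb{C}$-Zariski topology of $\mathbb{A}^m(\mathbb{C})$ (and hence also in the strong topology) and $\sigma$ defines a bijective finite morphism of $\overline{\mathcal{O}}$ onto $\mathcal{D}^*$. For any $\mathbb{C}$-irreducible component $\mathcal{C}$ of $\overline{\mathcal{O}}$ the restriction $\sigma:\mathcal{C}\to\sigma(\mathcal{C})$ is a birational (finite and bijective) morphism of $\mathcal{C}$ onto the $\mathbb{C}$-irreducible Zariski closed set $\sigma(\mathcal{C})$. The encoding of the object class $\overline{\mathcal{O}}$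 by the data structure $\mathcal{D}^*$ defined by $\omega^*:=\sigma^{-1}$ is continuous with respect to the $\mathbb{C}$-Zariski topologies of $\overline{\mathcal{O}}$ and $\mathcal{D}^*$. Moreover $\omega^*$ is holomorphic if and only if $\omega^*$ allows to answer holomorphically the value question about the object class $\overline{\mathcal{O}}$. Finally $\omega^*$ induces an encoding of the projective variety associated to the cone $\overline{\mathcal{O}}$ by the projective variety associated to the cone $\mathcal{D}^*$ which is continuous with respect to the strong topology.
   Context: A set is $\mathbb{Q}$-constructible (or $\mathbb{Q}$-definable) if it is a finite boolean combination of zero sets of polynomials over $\mathbb{Q}$. A set $\mathcal{O}\subset\mathbb{C}[Y_1,\ldots,Y_t]$ is a $\mathbb{Q}$-constructible object class of polynomial functions if its $\mathbb{C}$-linear span $W$ is finite dimensional with a basis consisting of polynomials in $\mathbb{Q}[Y_1,\ldots,Y_t]$ and $\mathcal{O}$ is a $\mathbb{Q}$-constructible subset of $W$ in coordinates with respect to such a basis; evaluation at suitably many rational points embeds $W$ linearly (over $\mathbb{Q}$) in an affine space $\mathbb{A}^N$, and $\mathcal{O}$ is viewed as a subset of $\mathbb{A}^N$. $\overline{\mathcal{O}}$ is its $\mathbb{Q}$-Zariski closure (it is contained in $W$). $\mathcal{O}$ is a cone if $\lambda F\in\mathcal{O}$ for all $\lambda\in\mathbb{C}$, $F\in\mathcal{O}$. A data structure of size $L$ is a constructible subset $\mathcal{D}\subset\mathbb{A}^L$ (a $\mathbb{Q}$-constructible one for $\mathbb{Q}$-definable encodings). An encoding of $\mathcal{O}$ is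 a surjective map $\omega:\mathcal{D}\to\mathcal{O}$. A $\mathbb{Q}$-definable holomorphic encoding is one that is the restriction to $\mathcal{D}$ of a polynomial map $\mathbb{A}^L\to\mathbb{A}^N$ with rational coefficients. For the encoding $\omega^*$, whose evaluation points are real, holomorphic means restriction of a polynomial map (over $\mathbb{C}$) of the ambient spaces, and $\omega^*$ allows to answer the value question holomorphically if there is a polynomial map $\rho:\mathbb{A}^m\times\mathbb{A}^t\to\mathbb{A}^1$ with $\rho(D,y)=\omega^*(D)(y)$ for all $D\in\mathcal{D}^*$ and $y\in\mathbb{A}^t$. The strong topology is the euclidean topology. *)

(* Defs.v *)
(* The notations of mpoly clash with those of MathComp-Analysis, so that file is
   imported without them. *)
From HB Require Import structures.
From mathcomp Require Import all_boot all_order all_algebra.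
From mathcomp Require Import generic_quotient.
From mathcomp Require Import all_classical all_reals topology normedtype.
From mathcomp Require Import complex.
From mathcomp Require Import -(notations) mpoly.

Set Implicit Arguments.
Unset Strict Implicit.
Unset Printing Implicit Defensive.

Import Order.TTheory GRing.Theory Num.Theory numFieldNormedType.Exports.

Local Open Scope classical_set_scope.
Local Open Scope ring_scope.

Notation "{ 'mpoly' T [ n ] }" := (mpoly n T)
  (at level 0, T, n at level 2, format "{ 'mpoly'  T [ n ] }").

(* Affine n-space over K is 'rV[K]_n; polynomials over a subfield of K are
   polynomials over a field k with a fixed embedding iota : k -> K. *)

Definition rveval (K : nzRingType) n (p : {mpoly K[n]}) (x : 'rV[K]_n) : K :=
  meval (fun i => x ord0 i) p.

Section ZariskiOver.
Variables (k : fieldType) (K : numClosedFieldType) (iota : {rmorphism k -> K}).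

Definition peval n (p : {mpoly k[n]}) (x : 'rV[K]_n) : K :=
  rveval (map_mpoly iota p) x.

Definition zariski_closed n (X : set 'rV[K]_n) : Prop :=
  exists P : set {mpoly k[n]}, X = [set x | forall p, P p -> peval p x = 0].

Definition zariski_closure n (X : set 'rV[K]_n) : set 'rV[K]_n :=
  smallest (@zariski_closed n) X.

Inductive constructible n : set 'rV[K]_n -> Prop :=
| constructible_zeros (p : {mpoly k[n]}) :
    constructible [set x | peval p x = 0]
| constructibleC X : constructible X -> constructible (~` X)
| constructibleU X Y :
    constructible X -> constructible Y -> constructible (X `|` Y).

Definition restricts_polynomial_map a b (D : set 'rV[K]_a)
    (g : 'rV[K]_a -> 'rV[K]_b) : Prop :=
  exists w : 'I_b -> {mpoly k[a]},
    forall x, D x -> forall j, g x ord0 j = peval (w j) x.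

Definition encoding (T : Type) a (D : set 'rV[K]_a) (O : set T)
    (omega : 'rV[K]_a -> T) : Prop :=
  [/\ constructible D, set_fun D O omega & set_surj D O omega].

End ZariskiOver.

Section ObjectClasses.
Variable K : numClosedFieldType.

Definition is_cone (V : lmodType K) (X : set V) : Prop :=
  forall (a : K) (x : V), X x -> X (a *: x).

Definition lin_span (V : lmodType K) (X : set V) : set V :=
  [set v | exists (r : nat) (a : 'I_r -> K) (u : 'I_r -> V),
     (forall i, X (u i)) /\ v = \sum_(i < r) a i *: u i].

(* The rows of P are s points of affine t-space. *)
Definition sample s t (P : 'M[K]_(s, t)) (F : {mpoly K[t]}) : 'rV[K]_s :=
  \row_(i < s) meval (fun j => P i j) F.

Definition comb d t (b : 'I_d -> {mpoly rat[t]}) (c : 'rV[K]_d) :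
    {mpoly K[t]} :=
  \sum_(i < d) c ord0 i *: map_mpoly (ratr : rat -> K) (b i).

Definition Qobject_class t (O : set {mpoly K[t]}) : Prop :=
  exists (d : nat) (b : 'I_d -> {mpoly rat[t]}),
    [/\ injective (comb b), range (comb b) = lin_span O
      & constructible (ratr : {rmorphism rat -> K}) (comb b @^-1` O)].

(* The rows of Q are the rational evaluation points; the resulting map into
   affine N-space is only required to be injective on the span of O. *)
Definition embed N t (Q : 'M[rat]_(N, t)) : {mpoly K[t]} -> 'rV[K]_N :=
  sample (map_mx (ratr : rat -> K) Q).

Definition embeds_span N t (Q : 'M[rat]_(N, t)) (O : set {mpoly K[t]}) : Prop :=
  set_inj (lin_span O) (embed Q).

Definition object_closure N t (Q : 'M[rat]_(N, t)) (O : set {mpoly K[t]}) :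
    set {mpoly K[t]} :=
  lin_span O `&` embed Q @^-1`
    (zariski_closure (ratr : {rmorphism rat -> K}) (embed Q @` O)).

Definition has_Qholomorphic_encoding L N t (Q : 'M[rat]_(N, t))
    (O : set {mpoly K[t]}) : Prop :=
  exists (D : set 'rV[K]_L) (omega : 'rV[K]_L -> {mpoly K[t]}),
    encoding (ratr : {rmorphism rat -> K}) D O omega /\
    restricts_polynomial_map (ratr : {rmorphism rat -> K}) D
      (embed Q \o omega).

Definition answers_value_holomorphically m t (D : set 'rV[K]_m)
    (omega : 'rV[K]_m -> {mpoly K[t]}) : Prop :=
  exists rho : {mpoly K[m + t]}, forall (x : 'rV[K]_m) (y : 'rV[K]_t),
    D x -> rveval rho (row_mx x y) = rveval (omega x) y.

End ObjectClasses.

(* Zariski geometry over K of a set X : set T of objects that is viewed inside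
   affine n-space through a map e : T -> 'rV[K]_n injective on X. *)

Section EmbeddedVarieties.
Variable K : numClosedFieldType.

Local Notation zclosed := (zariski_closed (idfun : {rmorphism K -> K})).

Definition closed_in T n (e : T -> 'rV[K]_n) (X Z : set T) : Prop :=
  exists2 V : set 'rV[K]_n, zclosed V & Z = X `&` e @^-1` V.

Definition open_in T n (e : T -> 'rV[K]_n) (X U : set T) : Prop :=
  exists2 Z, closed_in e X Z & U = X `\` Z.

Definition irreducible T n (e : T -> 'rV[K]_n) (X : set T) : Prop :=
  X !=set0 /\ forall Z1 Z2, closed_in e X Z1 -> closed_in e X Z2 ->
    X = Z1 `|` Z2 -> X = Z1 \/ X = Z2.

Definition irreducible_component T n (e : T -> 'rV[K]_n) (X C : set T) : Prop :=
  [/\ C `<=` X, irreducible e C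
    & forall C', irreducible e C' -> C `<=` C' -> C' `<=` X -> C' = C].

Definition zariski_continuous T n (e : T -> 'rV[K]_n) (X : set T)
    T' n' (e' : T' -> 'rV[K]_n') (Y : set T') (f : T -> T') : Prop :=
  set_fun X Y f /\
  forall Z, closed_in e' Y Z -> closed_in e X (X `&` f @^-1` Z).

(* X and Y are meant to be Zariski closed: polynomial restrictions are then the
   elements of the coordinate rings. *)
Definition variety_morphism T n (e : T -> 'rV[K]_n) (X : set T)
    T' n' (e' : T' -> 'rV[K]_n') (Y : set T') (f : T -> T') : Prop :=
  set_fun X Y f /\
  exists p : 'I_n' -> {mpoly K[n]}, forall x, X x ->
    forall i, e' (f x) ord0 i = rveval (p i) (e x).

(* K[X] is a finitely generated K[Y]-module, generated by the g_j. *)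
Definition finite_morphism T n (e : T -> 'rV[K]_n) (X : set T)
    T' n' (e' : T' -> 'rV[K]_n') (Y : set T') (f : T -> T') : Prop :=
  variety_morphism e X e' Y f /\
  exists (r : nat) (g : 'I_r -> {mpoly K[n]}),
    forall p : {mpoly K[n]}, exists h : 'I_r -> {mpoly K[n']},
      forall x, X x ->
        rveval p (e x) =
        \sum_(j < r) rveval (h j) (e' (f x))
                     * rveval (g j) (e x).

Definition regular_on T n (e : T -> 'rV[K]_n) (U : set T) (h : T -> K) : Prop :=
  forall u, U u -> exists p q : {mpoly K[n]},
    rveval q (e u) != 0 /\
    forall x, U x -> rveval q (e x) != 0 ->
      h x = rveval p (e x) / rveval q (e x).

Definition regular_map T n (e : T -> 'rV[K]_n) (U : set T)
    T' n' (e' : T' -> 'rV[K]_n') (V : set T') (f : T -> T') : Prop :=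
  set_fun U V f /\ forall i, regular_on e U (fun x => e' (f x) ord0 i).

(* X and Y are meant to be irreducible, so nonempty open subsets are dense. *)
Definition birational_morphism T n (e : T -> 'rV[K]_n) (X : set T)
    T' n' (e' : T' -> 'rV[K]_n') (Y : set T') (f : T -> T') : Prop :=
  variety_morphism e X e' Y f /\
  exists (U : set T) (V : set T') (g : T' -> T),
    [/\ open_in e X U /\ U !=set0, open_in e' Y V /\ V !=set0,
        regular_map e U e' V f, regular_map e' V e U g
      & (forall x, U x -> g (f x) = x) /\ (forall y, V y -> f (g y) = y)].

End EmbeddedVarieties.

(* The topology of 'rV[K]_n is the one given by the absolute value of K. *)

Section Projective.
Variable K : numClosedFieldType.

Definition strongly_closed n (X : set 'rV[K]_n) : Prop := closed X.

Definition punctured n : topologicalType :=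
  set_type [set x : 'rV[K]_n | x != 0].

Definition collinear n (x y : punctured n) : bool :=
  `[< exists2 a : K, a != 0 & \val y = a *: \val x >].

Lemma collinear_refl n : reflexive (@collinear n).
Proof. by move=> x; apply/asboolP; exists 1; rewrite ?oner_neq0 ?scale1r. Qed.

Lemma collinear_sym n : ssrbool.symmetric (@collinear n).
Proof.
have H x y : @collinear n x y -> collinear y x.
  move=> /asboolP[a a0 e]; apply/asboolP; exists a^-1; first by rewrite invr_eq0.
  by rewrite e scalerA mulVf// scale1r.
by move=> x y; apply/idP/idP; exact: H.
Qed.

Lemma collinear_trans n : transitive (@collinear n).
Proof.
move=> y x z /asboolP[a a0 e] /asboolP[b b0 e']; apply/asboolP.
by exists (b * a); rewrite ?mulf_neq0// e' e scalerA.
Qed.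

Canonical collinear_equiv n :=
  EquivRel (@collinear n) (@collinear_refl n) (@collinear_sym n)
    (@collinear_trans n).

(* Projective (n-1)-space with its strong topology. *)
Definition projective_space n : topologicalType :=
  quotient_topology {eq_quot (@collinear n)}%qT.

Definition proj_pt n (x : punctured n) : projective_space n :=
  (\pi_({eq_quot (@collinear n)}) x)%qT.

Definition projectivization n (X : set 'rV[K]_n) : set (projective_space n) :=
  @proj_pt n @` [set x | X (\val x)].

Definition induces_projective m n (X : set 'rV[K]_m) (Y : set 'rV[K]_n)
    (f : 'rV[K]_m -> 'rV[K]_n)
    (fP : set_type (projectivization X) -> set_type (projectivization Y)) :
    Prop :=
  forall (p : set_type (projectivization X)) (x : punctured m),
    X (\val x) -> \val p = proj_pt x ->
    exists2 y : punctured n, \val y = f (\val x) & \val (fP p) = proj_pt y.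

(* The map induced by f is an encoding (a surjection) of the projective set of
   the cone Y by that of the cone X, and is strongly continuous. *)
Definition induces_continuous_projective_encoding m n (X : set 'rV[K]_m)
    (Y : set 'rV[K]_n) (f : 'rV[K]_m -> 'rV[K]_n) : Prop :=
  exists fP : set_type (projectivization X) -> set_type (projectivization Y),
    [/\ induces_projective f fP, range fP = setT & continuous fP].

End Projective.

(* Main.v *)
(* Let S be the set of tuples whose m t coordinates are algebraically independent
   over Q; it is dense because a finite set of reals has a countable algebraic
   closure. Points of the closure X of O are zeros of all relations between the N
   coordinates of a polynomial map in L variables, so they have transcendence
   degree at most L. If F <> G in X agree at all the gamma_i, then each gamma_i
   has a coordinate algebraic over the other ones and the coordinates of F and G,
   and the m t independent coordinates of gamma are algebraic over
   2 L + m (t - 1) < m t numbers: hence sigma is injective on X.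

   In coordinates, sigma is a linear map which is injective on the closed cone X.
   It is a composition of projections dropping one coordinate, from centres that
   are not on the image cone. On such a cone some homogeneous polynomial does not
   vanish at the centre, so the dropped coordinate is integral over the others,
   which yields finiteness, and, through the norm of a second polynomial modulo
   this monic one, closedness of images. Birationality comes from a relation of
   minimal degree between a coordinate x_k and sigma(x): its only root in the
   fibre is x_k, so it is a power of a linear polynomial. Finally, the relations
   between x_k and sigma(x) specialise over a point to the multiples of a power of
   a linear polynomial, which makes the inverse of sigma strongly continuous. *)
Require Import Defs.
From HB Require Import structures.
From mathcomp Require Import all_boot all_order all_algebra.
From mathcomp Require Import generic_quotient.
From mathcomp Require Import all_classical all_reals topology normedtype sequences.
From mathcomp Require Import complex ring.
From mathcomp Require Import -(notations) mpoly.

Set Implicit Arguments.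
Unset Strict Implicit.
Unset Printing Implicit Defensive.

Import Order.TTheory GRing.Theory Num.Theory numFieldNormedType.Exports.

Local Open Scope classical_set_scope.
Local Open Scope ring_scope.

(** * Algebraic dependence over the rationals *)

Section AlgebraicClosureOperator.
Variable K : numFieldType.
Implicit Types (A B : set K) (x y : K) (s : seq K).

(** The clauses match [divring_closed], which makes the subfield Q(A) a field by the subtype
    mechanism. Division needs no side condition, as x / 0 is 0. *)
Inductive generated_field A : K -> Prop :=
| generated_gen x : A x -> generated_field A x
| generated1 : generated_field A 1
| generatedB x y :
    generated_field A x -> generated_field A y -> generated_field A (x - y)
| generated_div x y :
    generated_field A x -> generated_field A y -> generated_field A (x / y).

Definition Qfield A : {pred K} := fun x => `[< generated_field A x >].

Lemma QfieldP A x : reflect (generated_field A x) (x \in Qfield A).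
Proof. exact: asboolP. Qed.

Lemma Qfield_divring_closed A : divring_closed (Qfield A).
Proof.
split=> [|x y /QfieldP Ax /QfieldP Ay|x y /QfieldP Ax /QfieldP Ay];
  apply/QfieldP; [exact: generated1|exact: generatedB|exact: generated_div].
Qed.

HB.instance Definition _ A :=
  GRing.isDivringClosed.Build K (Qfield A) (Qfield_divring_closed A).

Definition Qfield_type A := {x : K | x \in Qfield A}.
HB.instance Definition _ A := SubType.on (Qfield_type A).
HB.instance Definition _ A := Choice.on (Qfield_type A).
HB.instance Definition _ A := [SubChoice_isSubIntegralDomain of Qfield_type A by <:].
HB.instance Definition _ A := [SubIntegralDomain_isSubField of Qfield_type A by <:].

(** The relative algebraic closure of Q(A) in [K]: the closure operator of the matroid of algebraic
    dependence. *)
Definition acl A : set K := algebraicOver (val : Qfield_type A -> K).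

Lemma aclP A x : acl A x <-> exists p : {poly K},
  [/\ p != 0, p \is a polyOver (Qfield A) & root p x].
Proof.
split=> [[p p0 px]|[p [p0 /polyOverP pA px]]].
  exists (map_poly val p); split=> //; first by rewrite map_poly_eq0.
  by apply/polyOverP => i; rewrite coef_map; exact: valP.
pose q : {poly Qfield_type A} := \poly_(i < size p) (Sub p`_i (pA i)).
have qp : map_poly val q = p.
  apply/polyP => i; rewrite coef_map coef_poly /=.
  by case: ltnP => [_|pi] //=; rewrite nth_default.
by exists q; rewrite ?qp// -(map_poly_eq0 (val : {rmorphism Qfield_type A -> K})) qp.
Qed.
End AlgebraicClosureOperator.

Section AlgebraicClosureOperatorTheory.
Variable K : numFieldType.
Implicit Types (A B : set K) (x y : K) (s : seq K).

Lemma acl_gen A x : x \in Qfield A -> acl A x.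
Proof. by move=> xA; rewrite -[x]/(val (exist _ x xA)); exact: algebraic_id. Qed.

Lemma acl_sub A : A `<=` acl A.
Proof. by move=> x Ax; apply: acl_gen; apply/QfieldP; exact: generated_gen. Qed.

Lemma generated_field_sub A B x :
  (forall y, A y -> generated_field B y) -> generated_field A x ->
  generated_field B x.
Proof.
move=> AB; elim=> [y /AB//||y z _ + _|y z _ + _];
  by [exact: generated1|exact: generatedB|exact: generated_div].
Qed.

Lemma acl_mono A B : A `<=` B -> acl A `<=` acl B.
Proof.
move=> AB x /aclP[p [p0 /polyOverP pA px]]; apply/aclP; exists p; split=> //.
apply/polyOverP => i; apply/QfieldP; move: (pA i) => /QfieldP.
by apply: generated_field_sub => y /AB; exact: generated_gen.
Qed.

Lemma acl_closed A x : generated_field (acl A) x -> acl A x.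
Proof.
elim=> [//||y z _ + _|y z _ + _]; first exact: algebraic1.
  exact: algebraic_sub.
exact: algebraic_div.
Qed.

(** Over a field algebraic and integral elements coincide, and integrality is transitive. *)
Lemma acl_root A (p : {poly K}) x :
  p != 0 -> (forall i, acl A p`_i) -> root p x -> acl A x.
Proof.
move=> p0 pA px; apply/integral_algebraic; apply: (integral_root p0 px).
by apply/integral_poly => i; apply/integral_algebraic; exact: pA.
Qed.

Lemma acl_idem A : acl (acl A) `<=` acl A.
Proof.
move=> x /aclP[p [p0 /polyOverP pA px]]; apply: (acl_root p0) px => i.
by apply: acl_closed; apply/QfieldP; exact: pA.
Qed.

Lemma common_denominator (T : set K) (p : {poly K}) :
  T 1 -> (forall x y, T x -> T y -> T (x * y)) ->
  (forall i, exists a b, [/\ T a, T b, b != 0 & p`_i = a / b]) ->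
  exists b, [/\ T b, b != 0 & forall i, T (b * p`_i)].
Proof.
move=> T1 TM pT.
have [b [Tb b0 bp]] : exists b, [/\ T b, b != 0 &
    forall i, (i < size p)%N -> T (b * p`_i)].
  elim: (size p) => [|n [b [Tb b0 bp]]]; first by exists 1; rewrite oner_neq0.
  have [c [d [Tc Td d0 pn]]] := pT n.
  exists (d * b); split; [exact: TM|by rewrite mulf_neq0|].
  move=> i; rewrite ltnS leq_eqVlt => /predU1P[->|/bp Ti].
    by rewrite pn (_ : _ * _ = b * c); [exact: TM|field].
  by rewrite -mulrA; exact: TM.
have [c [d [Tc Td d0 pn]]] := pT (size p).
(* The coefficient at index [size p] is 0 = c / d, so its numerator [c] is 0 and lies in [T]; this
   settles all indices past the size. *)
have T0 : T 0.
  move: pn; rewrite nth_default// => /esym/eqP; rewrite mulf_eq0 invr_eq0.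
  by rewrite (negPf d0) orbF => /eqP <-.
by exists b; split=> // i; case: (ltnP i (size p)) => [/bp//|pi];
  rewrite nth_default// mulr0.
Qed.

Lemma generated_fieldU1 A y x : generated_field (y |` A) x ->
  exists a b : {poly K}, [/\ a \is a polyOver (Qfield A),
    b \is a polyOver (Qfield A), b.[y] != 0 & x = a.[y] / b.[y]].
Proof.
elim=> [z [->|Az]||_ _ _ [a [b [aA bA b0 ->]]] _ [c [d [cA dA d0 ->]]]
               |_ _ _ [a [b [aA bA b0 ->]]] _ [c [d [cA dA d0 ->]]]].
- by exists 'X, 1; split; rewrite ?polyOverX ?rpred1 ?hornerE ?oner_neq0 ?divr1.
- have zA : z \in Qfield A by apply/QfieldP; exact: generated_gen.
  by exists z%:P, 1; split; rewrite ?polyOverC ?rpred1 ?hornerE ?oner_neq0 ?divr1.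
- by exists 1, 1; rewrite rpred1 hornerC oner_neq0 divr1.
- exists (a * d - c * b), (b * d); split; rewrite ?rpredB ?rpredM// !hornerE.
    by rewrite mulf_neq0.
  by field; apply/andP.
- have [c0|c0] := eqVneq c.[y] 0.
    by exists 0, 1; rewrite rpred0 rpred1 horner0 hornerC oner_neq0 c0 !mul0r invr0 mulr0.
  exists (a * d), (b * c); split; rewrite ?rpredM// !hornerE ?mulf_neq0//.
  by rewrite invf_div mulf_div.
Qed.

(** After clearing denominators, a relation for [x] over Q(A, y) is a polynomial in two variables
    over Q(A). Read as a polynomial in [y] over Q(A, x) it is still non-zero, since otherwise one of
    its coefficients would be an equation for [x] over Q(A). *)
Lemma acl_exchange A x y :
  acl (y |` A) x -> ~ acl A x -> acl (x |` A) y.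
Proof.
move=> /aclP[p [p0 /polyOverP pA px]] nx.
pose T := [set z | exists2 q : {poly K}, q \is a polyOver (Qfield A) & z = q.[y]].
have [||i|b [_ b0 bT]] := @common_denominator T p.
- by exists 1; rewrite ?rpred1// hornerE.
- by move=> _ _ [q qA ->] [r rA ->]; exists (q * r); rewrite ?rpredM// hornerM.
- have /QfieldP/generated_fieldU1[a [c [aA cA c0 ->]]] := pA i.
  by exists a.[y], c.[y]; split=> //; [exists a|exists c].
have /choice[q qP] : forall i, exists q : {poly K},
    q \is a polyOver (Qfield A) /\ b * p`_i = q.[y].
  by move=> i; have [q] := bT i; exists q.
pose m := (\max_(i < size p) size (q i))%N.
(* The polynomial [c j] is the coefficient of Y^j in the sum of the q_i(Y) X^i, and [r] is that sum
   at X = x. *)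
pose c j := \poly_(i < size p) (q i)`_j.
pose r := \poly_(j < m) (c j).[x].
have cA j : c j \is a polyOver (Qfield A).
  by rewrite polyOver_poly// => i _; apply: polyOverP; have [] := qP i.
have ry : r.[y] = 0.
  transitivity ((b *: p).[x]); last by rewrite hornerZ (rootP px) mulr0.
  rewrite horner_poly (horner_coef_wide _ (size_scale_leq _ _)).
  under eq_bigr do rewrite horner_poly big_distrl.
  rewrite exchange_big; apply: eq_bigr => i _; rewrite /= coefZ.
  have [_ ->] := qP i; rewrite (@horner_coef_wide _ m); last exact: leq_bigmax.
  by rewrite big_distrl; apply: eq_bigr => j _; rewrite /= mulrAC.
have [r0|r0] := eqVneq r 0; last first.
  apply/aclP; exists r; split=> //; last exact/rootP.
  apply: polyOver_poly => j _; apply: rpred_horner; last first.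
    by apply/QfieldP; apply: generated_gen; left.
  apply/polyOverP => i; apply/QfieldP; have /polyOverP/(_ i)/QfieldP := cA j.
  by apply: generated_field_sub => z Az; apply: generated_gen; right.
have c0 j : (j < m)%N -> c j = 0.
  move=> jm; apply/eqP; apply: contra_notT nx => cj; apply/aclP.
  exists (c j); split=> //; apply/rootP; have := congr1 (fun r : {poly K} => r`_j) r0.
  by rewrite coef_poly jm coef0.
case/eqP: p0; apply/polyP => i; rewrite coef0.
have [pi|pi] := ltnP i (size p); last by rewrite nth_default.
suff q0 : q i = 0.
  have [_] := qP i; rewrite q0 horner0 => /eqP.
  by rewrite mulf_eq0 (negPf b0) => /eqP.
apply/polyP => j; rewrite coef0; have [jm|jm] := ltnP j m.
  by have := congr1 (fun r : {poly K} => r`_i) (c0 _ jm); rewrite coef_poly pi coef0.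
rewrite nth_default//; apply: leq_trans jm.
exact: (@leq_bigmax _ (fun i : 'I_(size p) => size (q i)) (Ordinal pi)).
Qed.

End AlgebraicClosureOperatorTheory.

(** * Polynomials in n + 1 variables as polynomials in the last one *)

Section MpolyLastVariable.
Variables (R : comNzRingType) (n : nat).

Local Notation widen := (widen_ord (leqnSn _)).

Lemma muniX (m : multinom n.+1) :
  muni (mpolyX R m) =
  mpolyX R (Multinom (mktuple (fun i => m (widen i)))) *: 'X^(m ord_max).
Proof. by rewrite muniE msuppX big_seq1 mcoeffX eqxx scale1r. Qed.

Lemma multinom_rcons_max (m : multinom n) i :
  Multinom (rcons_tuple m i) ord_max = i.
Proof. by rewrite (mnm_nth 0%N) /= nth_rcons size_tuple ltnn eqxx. Qed.

Lemma multinom_rcons_widen (m : multinom n) i j :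
  Multinom (rcons_tuple m i) (widen j) = m j.
Proof. by rewrite !(mnm_nth 0%N) /= nth_rcons size_tuple ltn_ord. Qed.

Lemma multinom_rcons (m : multinom n.+1) :
  m = Multinom (rcons_tuple (Multinom (mktuple (fun i => m (widen i)))) (m ord_max)).
Proof.
apply/mnmP => j; case: (unliftP ord_max j) => [k|] ->.
  have -> : lift ord_max k = widen k by apply: val_inj; rewrite /= /bump leqNgt ltn_ord.
  by rewrite multinom_rcons_widen mnmE.
by rewrite multinom_rcons_max.
Qed.

Lemma mcoeff_muni (p : {mpoly R[n.+1]}) (m : multinom n) i :
  mcoeff m (muni p)`_i = mcoeff (Multinom (rcons_tuple m i)) p.
Proof.
elim/mpolyind: p => [|c M p _ _ IH]; first by rewrite muni0 coef0 mcoeff0 mcoeff0.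
rewrite muniD coefD !mcoeffD; congr (_ + _); last exact: IH.
rewrite muniZ.
rewrite coefZ mcoeffCM mcoeffZ; congr (_ * _).
rewrite muniX coefZ coefXn mulr_natr mcoeffMn !mcoeffX -mulrnA mulnb.
congr (nat_of_bool _)%:R; apply/andP/eqP => [[/eqP <- /eqP ->]|->].
  by rewrite -multinom_rcons.
split; last by rewrite multinom_rcons_max.
by apply/eqP/mnmP => j; rewrite mnmE multinom_rcons_widen.
Qed.

Lemma muni_eq0 (p : {mpoly R[n.+1]}) : muni p = 0 -> p = 0.
Proof.
move=> p0; apply/mpolyP => m.
rewrite (multinom_rcons m).
by rewrite -mcoeff_muni p0 coef0 mcoeff0 mcoeff0.
Qed.

Lemma meval_muni (v : 'I_n.+1 -> R) (p : {mpoly R[n.+1]}) :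
  meval v p = (map_poly (meval (v \o widen)) (muni p)).[v ord_max].
Proof.
elim/mpolyind: p => [|c M p _ _ IH].
  by rewrite muni0 map_poly0 meval0 horner0.
rewrite muniD mevalD rmorphD hornerD; congr (_ + _); last exact: IH.
rewrite mevalZ muniZ -mul_polyC rmorphM /= map_polyC hornerCM /= mevalC; congr (_ * _).
rewrite muniX -mul_polyC rmorphM /= map_polyC hornerCM /= map_polyXn hornerXn.
rewrite !mevalX big_ord_recr.
by congr (_ * _); apply: eq_bigr => i _; rewrite mnmE.
Qed.

Lemma meval_mwiden (v : 'I_n.+1 -> R) (p : {mpoly R[n]}) :
  meval v (mwiden p) = meval (v \o widen) p.
Proof.
elim/mpolyind: p => [|c M p _ _ IH]; first by rewrite mwiden0 meval0 meval0.
rewrite mwidenD !mevalD; congr (_ + _); last exact: IH.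
rewrite mwidenZ !mevalZ mwidenX !mevalX big_ord_recr /=.
rewrite mnmwiden_ordmax expr0 mulr1.
by congr (_ * _); apply: eq_bigr => i _; rewrite mnmwiden_widen.
Qed.

End MpolyLastVariable.

Lemma map_mpoly_mwiden (R S : comNzRingType) (f : {rmorphism R -> S}) n
    (p : {mpoly R[n]}) :
  map_mpoly f (mwiden p) = mwiden (map_mpoly f p).
Proof.
elim/mpolyind: p => [|c M p _ _ IH].
  by rewrite mwiden0 !raddf0.
rewrite mwidenD !raddfD /=; congr (_ + _); last exact: IH.
by rewrite mwidenZ !map_mpolyZ mwidenZ mwidenX !map_mpolyX mwidenX.
Qed.

Lemma mpoly0C (R : comNzRingType) (p : {mpoly R[0]}) :
  p = mpolyC 0 (mcoeff (@mnm0 0) p).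
Proof.
apply/mpolyP => m; have -> : m = (@mnm0 0) by apply/mnmP; case.
by rewrite mcoeffC eqxx mulr1.
Qed.

(** In characteristic zero the numbers 0, ..., size p - 1 are distinct, and they are one more than
    the degree. *)
Lemma poly_nonroot (F : numFieldType) (p : {poly F}) : p != 0 -> exists x, ~~ root p x.
Proof.
move=> p0; pose s := [seq k%:R | k <- iota 0 (size p)] : seq F.
have us : uniq s by rewrite map_inj_uniq ?iota_uniq//; apply/mulrIn; exact: oner_neq0.
have /allPn[x _ px] : ~~ all (root p) s.
  apply/negP => ps; have := max_poly_roots p0 ps us.
  by rewrite size_map size_iota ltnn.
by exists x.
Qed.

Lemma nth_map_enum_ord (T : Type) (x0 : T) n (f : 'I_n -> T) (i : 'I_n) :
  nth x0 [seq f j | j <- enum 'I_n] i = f i.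
Proof. by rewrite (nth_map i) ?nth_ord_enum// size_enum_ord. Qed.

(** * Algebraically independent sequences and the exchange theorem *)

Section AlgebraicIndependence.
Variable K : numFieldType.
Implicit Types (A B : set K) (x y : K) (s t : seq K).

Local Notation widen := (widen_ord (leqnSn _)).

(** Each entry is compared with the earlier ones only, which suits the construction of sequences by
    appending; by the exchange property the order does not matter. *)
Definition independent A s :=
  forall s1 x s2, s = s1 ++ x :: s2 -> ~ acl (A `|` [set` s1]) x.

Lemma independent_rcons A s x :
  independent A (rcons s x) <->
  independent A s /\ ~ acl (A `|` [set` s]) x.
Proof.
split=> [sx|[sA xs] s1 y s2].
  split=> [s1 y s2 ss|]; last by apply: (sx s x [::]); rewrite cats1.
  by apply: (sx s1 y (rcons s2 x)); rewrite ss rcons_cat.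
case/lastP: s2 => [|s2 z].
  by rewrite cats1 => /rcons_inj[<- <-].
by rewrite -rcons_cons -rcons_cat => /rcons_inj[ss _]; exact: sA ss.
Qed.

Lemma acl_trans A B x : A `<=` acl B -> acl A x -> acl B x.
Proof. by move=> AB /(acl_mono AB)/acl_idem. Qed.

(** The entry [y] is the one at which [x] first becomes algebraic; the exchange property then
    applies to [x] and [y]. *)
Lemma acl_first A t x : acl (A `|` [set` t]) x -> ~ acl A x ->
  exists t1 y t2, [/\ t = t1 ++ y :: t2, acl (y |` (A `|` [set` t1])) x
    & ~ acl (A `|` [set` t1]) x].
Proof.
elim/last_ind: t => [|t y IH] xt xA.
  by exfalso; apply: xA; apply: acl_mono xt => z [].
have [/IH/(_ xA)[t1 [z [t2 [-> ? ?]]]]|nt] := pselect (acl (A `|` [set` t]) x).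
  by exists t1, z, (rcons t2 y); rewrite rcons_cat.
exists t, y, [::]; rewrite cats1; split=> //.
apply: acl_mono xt => z [|]; first by right; left.
by rewrite /= mem_rcons inE => /orP[/eqP->|]; [left|right; right].
Qed.

Lemma steinitz A s t : independent A s ->
  (forall x, x \in s -> acl (A `|` [set` t]) x) -> (size s <= size t)%N.
Proof.
move=> sA st.
(* The elements of [s] are exchanged one by one for elements of [t]; [t'] is what remains of [t]. *)
suff [t' [<- _]] : exists t', (size t' + size s = size t)%N /\
    forall x, x \in t -> acl (A `|` [set` s] `|` [set` t']) x.
  exact: leq_addl.
elim/last_ind: s sA st => [_ _|s x IH /independent_rcons[sA xs] st].
  by exists t; rewrite addn0; split=> // x xt; apply: acl_sub; right.
have [|t' [st' tt']] := IH sA.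
  by move=> y ys; apply: st; rewrite mem_rcons inE ys orbT.
have [] := @acl_first (A `|` [set` s]) t' x _ xs.
  apply: (@acl_trans (A `|` [set` t])); last by apply: st; rewrite mem_rcons mem_head.
  by move=> y [Ay|/tt'//]; apply: acl_sub; left; left.
move=> t1 [y [t2 [t'E yx xt1]]]; exists (t1 ++ t2); split.
  by rewrite -st' t'E !size_cat size_rcons /= !addnS addSn.
have yt := acl_exchange yx xt1.
move=> z /tt'; apply: acl_trans => w [[Aw|ws]|].
- by apply: acl_sub; left; left.
- by apply: acl_sub; left; right; rewrite /= mem_rcons inE ws orbT.
rewrite t'E /= mem_cat inE => /or3P[wt1|/eqP ->|wt2].
- by apply: acl_sub; right; rewrite /= mem_cat wt1.
- apply: acl_mono yt => v [->|[[Av|vs]|vt1]].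
  + by left; right; rewrite /= mem_rcons mem_head.
  + by left; left.
  + by left; right; rewrite /= mem_rcons inE vs orbT.
  + by right; rewrite /= mem_cat vt1.
- by apply: acl_sub; right; rewrite /= mem_cat wt2 orbT.
Qed.

Lemma transcendence_basis A s : exists t,
  [/\ {subset t <= s}, independent A t &
      forall x, x \in s -> acl (A `|` [set` t]) x].
Proof.
elim: s => [|x s [t [ts tA st]]].
  by exists [::]; split=> //; case.
have [xt|xt] := pselect (acl (A `|` [set` t]) x).
  exists t; split=> // [y /ts|y]; rewrite inE; first by move->; rewrite orbT.
  by case/predU1P=> [->//|/st].
exists (rcons t x); split.
- by move=> y; rewrite mem_rcons !inE => /orP[->//|/ts ->]; rewrite orbT.
- exact/independent_rcons.
- move=> y; rewrite inE => /predU1P[->|/st].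
    by apply: acl_sub; right; rewrite /= mem_rcons mem_head.
  by apply: acl_mono => z [|zt]; [left|right; rewrite /= mem_rcons inE zt orbT].
Qed.

(** By induction some coefficient of [p] in the last variable is non-zero at the first entries, so
    that a zero value would make the last entry algebraic over them. *)
Lemma independent_meval A n s (p : {mpoly K[n]}) :
  size s = n -> independent A s -> p != 0 -> (forall m, acl A (mcoeff m p)) ->
  meval (fun i : 'I_n => s`_i) p != 0.
Proof.
elim: n s p => [|n IH] s p.
  move=> _ _ p0 _; move: p0; rewrite [p]mpoly0C mevalC mpolyC_eq0.
  by [].
case/lastP: s => [//|s x]; rewrite size_rcons => -[sn].
move=> /independent_rcons[sA xs] p0 pA; apply/negP => /eqP px; apply: xs.
rewrite meval_muni /= nth_rcons sn ltnn eqxx in px.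
pose q := map_poly (meval (fun i : 'I_n => s`_i)) (muni p).
have qE i : q`_i = meval (fun i : 'I_n => s`_i) (muni p)`_i by rewrite coef_map.
have px' : root q x.
  apply/rootP; rewrite -px; congr (_.[_]); apply: eq_map_poly => r.
  by apply: meval_eq => i /=; rewrite nth_rcons sn ltn_ord.
apply: (acl_root _ _ px'); last first.
  move=> i; rewrite qE mevalE; apply: acl_closed.
  apply/QfieldP/rpred_sum => m _; apply: rpredM; last first.
    apply: rpred_prod => j _; apply: rpredX; apply/QfieldP/generated_gen.
    by apply: acl_sub; right; apply: mem_nth; rewrite sn.
  apply/QfieldP/generated_gen; rewrite mcoeff_muni.
  by apply: acl_mono (pA _) => y Ay; left.
have [i pi] : exists i, (muni p)`_i != 0.
  have mp0 : muni p != 0 by apply: contra_neq p0 => /muni_eq0.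
  by exists (size (muni p)).-1; rewrite -lead_coefE lead_coef_eq0.
apply/negP => /eqP q0; have := IH s _ sn sA pi.
rewrite -qE q0 coef0 eqxx => /(_ _)/negP; apply=> // m.
by rewrite mcoeff_muni.
Qed.

Lemma generated_field_mpoly n s x : size s = n -> generated_field [set` s] x ->
  exists a b : {mpoly rat[n]},
    meval (fun i : 'I_n => s`_i) (map_mpoly (ratr : rat -> K) b) != 0 /\
    x = meval (fun i : 'I_n => s`_i) (map_mpoly (ratr : rat -> K) a) /
        meval (fun i : 'I_n => s`_i) (map_mpoly (ratr : rat -> K) b).
Proof.
pose ev p := meval (fun i : 'I_n => s`_i) (map_mpoly (ratr : rat -> K) p).
move=> sn sx; suff: exists a b, ev b != 0 /\ x = ev a / ev b by [].
have ev1 : ev 1 = 1 by rewrite /ev rmorph1 meval1.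
have evB p q : ev (p - q) = ev p - ev q by rewrite /ev rmorphB mevalB.
have evM p q : ev (p * q) = ev p * ev q by rewrite /ev rmorphM mevalM.
have evX i : ev (mpolyX rat (mnm1 i)) = s`_i by rewrite /ev map_mpolyX mevalXU.
clearbody ev; elim: sx => [y ys||y z _ [a [b [b0 ->]]] _ [c [d [d0 ->]]]
             |y z _ [a [b [b0 ->]]] _ [c [d [d0 ->]]]].
- have ys' : (index y s < n)%N by rewrite -sn index_mem.
  exists (mpolyX _ (mnm1 (Ordinal ys'))), 1; rewrite ev1 oner_neq0 divr1.
  by split=> //; rewrite evX nth_index.
- by exists 1, 1; rewrite ev1 oner_neq0 divr1.
- exists (a * d - c * b), (b * d); rewrite evB !evM mulf_neq0//; split=> //.
  by rewrite -mulNr addf_div// mulNr.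
- have [c0|c0] := eqVneq (ev c) 0.
    by exists (1 - 1), 1; rewrite evB ev1 oner_neq0 c0 subrr !mul0r invr0 mulr0.
  exists (a * d), (b * c); rewrite !evM mulf_neq0//; split=> //.
  by rewrite invf_div mulf_div.
Qed.

(** Either the first entries are already dependent, or the last one is algebraic over them and
    clearing denominators in its equation [p] gives the relation. *)
Lemma dependent_mpoly n s : size s = n -> ~ independent set0 s ->
  exists p : {mpoly rat[n]}, p != 0 /\
    meval (fun i : 'I_n => s`_i) (map_mpoly (ratr : rat -> K) p) = 0.
Proof.
elim: n s => [|n IH] s; first by case: s => [_ []|//] [|? ?].
case/lastP: s => [//|s x]; rewrite size_rcons => -[sn] dep.
have vE : (fun i : 'I_n.+1 => (rcons s x)`_i) \o widen =1 (fun i : 'I_n => s`_i).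
  by move=> i /=; rewrite nth_rcons sn ltn_ord.
have wE (q : {mpoly rat[n]}) :
    meval (fun i : 'I_n.+1 => (rcons s x)`_i) (map_mpoly (ratr : rat -> K) (mwiden q)) =
    meval (fun i : 'I_n => s`_i) (map_mpoly (ratr : rat -> K) q).
  by rewrite map_mpoly_mwiden meval_mwiden; exact: meval_eq.
have [ind|/(IH _ sn)[p [p0 ps]]] := pselect (independent set0 s); last first.
  exists (mwiden p); rewrite wE; split=> //.
  by apply: contra_neq p0; rewrite -(mwiden0 n) => /inj_mwiden.
have /aclP[p [p0 /polyOverP pA px]] : acl [set` s] x.
  apply: contrapT => ns; apply: dep; apply/independent_rcons; split=> //.
  by rewrite set0U.
pose ev q := meval (fun i : 'I_n => s`_i) (map_mpoly (ratr : rat -> K) q).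
have evM q r : ev (q * r) = ev q * ev r by rewrite /ev rmorphM mevalM.
pose T := [set z | exists q : {mpoly rat[n]}, z = ev q].
have [|||b [_ b0 bT]] := @common_denominator K T p.
- by exists 1; rewrite /ev rmorph1 meval1.
- by move=> _ _ [q ->] [r ->]; exists (q * r).
- move=> i; have /QfieldP/(generated_field_mpoly sn)[a [c [c0 ->]]] := pA i.
  by exists (ev a), (ev c); split=> //; [exists a|exists c].
have /choice[q qP] := bT.
pose P := \sum_(i < size p) mwiden (q i) * mpolyX rat (mnm1 ord_max) ^+ i.
have PE y : meval (fun i : 'I_n.+1 => (rcons s y)`_i) (map_mpoly (ratr : rat -> K) P) =
    b * p.[y].
  rewrite -hornerZ (@horner_coef_wide _ (size p)) ?size_scale_leq//.
  rewrite /P (rmorph_sum (map_mpoly _)) (rmorph_sum (meval _)); apply: eq_bigr => i _ /=.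
  rewrite !rmorphM !rmorphXn /= map_mpolyX mevalXU /= nth_rcons sn ltnn eqxx.
  rewrite coefZ qP map_mpoly_mwiden meval_mwiden; congr (_ * _).
  by apply: meval_eq => j /=; rewrite nth_rcons sn ltn_ord.
exists P; split; last by rewrite PE (rootP px) mulr0.
(* That [P] is not zero is seen by replacing the last entry by a value that is no root of [p]. *)
have [y py] := poly_nonroot p0.
apply: contraNneq py => P0; rewrite /root -(mulrI_eq0 _ (lregP b0)).
by rewrite -PE P0 raddf0 meval0.
Qed.

End AlgebraicIndependence.

(** * Density of the tuples with algebraically independent coordinates *)

Lemma countable_dense_avoid (R : realType) (B : set R) (x e : R) :
  countable B -> 0 < e -> exists2 y, `|x - y| < e & ~ B y.
Proof.
move=> /countable_injP[f fB] e0.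
(* The set [F n] omits at most the point of [B] numbered n, so it is open and dense; Baire's theorem
   gives a common point near [x]. *)
pose F n := ~` [set y | B y /\ f y = n].
have Fsub n : exists z, [set y | B y /\ f y = n] `<=` [set z].
  have [[z [Bz fz]]|no] := pselect ([set y | B y /\ f y = n] !=set0).
    exists z => y [By fy]; apply: fB; rewrite ?inE// fy; exact: esym.
  by exists 0 => y By; exfalso; apply: no; exists y.
have openF n : open (F n).
  apply: closed_openC; have [z zn] := Fsub n.
  have [E|no] := pselect ([set y | B y /\ f y = n] z).
    rewrite (_ : [set y | _] = [set z]); first exact: closed_eq.
    by apply/seteqP; split=> // _ ->.
  rewrite (_ : [set y | _] = set0); first exact: closed0.
  by apply/seteqP; split=> // y yn; apply: no; rewrite -(zn _ yn).
have denseF n : dense (F n).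
  move=> U [y Uy] Uo.
  have [z zn] := Fsub n.
  have /nbhs_ballP[d d0 dU] : nbhs y U by apply: open_nbhs_nbhs.
  have [yz|yz] := eqVneq y z; last first.
    by exists y; split=> // /zn yz'; rewrite yz' eqxx in yz.
  exists (y + d / 2); split.
    apply: dU; rewrite /ball /= opprD addNKr normrN gtr0_norm ?divr_gt0//.
    by rewrite ltr_pdivrMr// ltr_pMr// ltr1n.
  move=> /zn /eqP; rewrite yz -subr_eq0 addrAC subrr add0r.
  by rewrite gt_eqF// divr_gt0.
have := @Baire R (R^o : completeNormedModType R) F (fun n => conj (openF n) (denseF n)).
move=> /(_ (ball x e)) [|//|y [xy Fy]].
- by exists x; exact: ballxx.
- exact: ball_open.
by exists y => // By; apply: (Fy (f y)).
Qed.

(** After clearing denominators, an algebraic element is a root of a polynomial whose coefficients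
    are rational polynomials in [s]. Such equations are coded by finite lists of exponents and
    rationals, a countable type, and each has finitely many roots. *)
Lemma countable_acl (K : numClosedFieldType) (s : seq K) : countable (acl [set` s]).
Proof.
pose ev (l : seq (multinom (size s) * rat)) :=
  \sum_(c <- l) ratr c.2 * \prod_(i < size s) s`_i ^+ c.1 i.
pose P (c : seq (seq (multinom (size s) * rat))) := Poly [seq ev l | l <- c].
pose Z c := [set x | P c != 0 /\ root (P c) x].
apply: (@sub_countable _ _ _ (\bigcup_c Z c)); last first.
  apply: bigcup_countable => // c _; rewrite /Z.
  have [P0|P0] := eqVneq (P c) 0.
    by apply: (@sub_countable _ _ _ set0) => //; apply: subset_card_le => x [].
  apply: finite_set_countable.
  have [r rP] := closed_field_poly_normal (P c).
  apply: (@sub_finite_set _ _ [set` r]); last exact: finite_seq.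
  move=> x [_]; rewrite rP rootZ ?lead_coef_eq0// root_prod_XsubC//.
apply: subset_card_le => x /aclP[p [p0 /polyOverP pA px]].
pose evp (p : {mpoly rat[size s]}) :=
  [seq (m, mcoeff m p) | m <- msupp p].
have evE q : meval (fun i : 'I_(size s) => s`_i) (map_mpoly (ratr : rat -> K) q) = ev (evp q).
  rewrite mevalE (perm_big _ (msupp_map_mpoly _ (fmorph_inj _))) /=.
  by rewrite /ev /evp [RHS]big_map; apply: eq_bigr => m _; rewrite mcoeff_map_mpoly.
pose E q := meval (fun i : 'I_(size s) => s`_i) (map_mpoly (ratr : rat -> K) q).
have [|||b [_ b0 bT]] := @common_denominator K [set z | exists q, z = E q] p.
- by exists 1; rewrite /E rmorph1 meval1.
- by move=> _ _ [q ->] [r ->]; exists (q * r); rewrite /E rmorphM mevalM.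
- move=> i; have /QfieldP/(generated_field_mpoly erefl)[a [c [c0 ->]]] := pA i.
  by exists (E a), (E c); split=> //; [exists a|exists c].
have /choice[q qP] := bT.
exists (mkseq (fun i => evp (q i)) (size p)) => //.
have PE : P (mkseq (fun i => evp (q i)) (size p)) = b *: p.
  apply/polyP => i; rewrite coef_Poly coefZ -map_comp.
  have [pi|pi] := ltnP i (size p); last first.
    by rewrite [p`_i]nth_default// mulr0 nth_default// size_map size_iota.
  by rewrite (nth_map 0%N) ?size_iota// nth_iota// add0n /= -evE qP.
split; first by rewrite PE scaler_eq0 negb_or b0.
by rewrite PE rootZ.
Qed.

Section DenseIndependent.
Variable (R : realType).

(** The values are moved one at a time, each off the countable algebraic closure of the previous
    ones. *)
Lemma independent_approx (I : eqType) (f : I -> R) (e : R) (l : seq I) :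
  0 < e -> uniq l -> exists g : I -> R, (forall i, `|f i - g i| < e) /\
    independent set0 [seq real_complex R (g i) | i <- l].
Proof.
move=> e0; elim/last_ind: l => [_|l i IH].
  by exists f; split=> [i|]; [rewrite subrr normr0|case].
rewrite rcons_uniq => /andP[il /IH[g [gf gl]]].
pose B := [set x : R | acl [set` [seq real_complex R (g i) | i <- l]] (real_complex R x)].
have [|x xi Bx] := @countable_dense_avoid _ B (f i) e _ e0.
  have /countable_injP[h hB] := countable_acl [seq real_complex R (g i) | i <- l].
  apply/countable_injP; exists (h \o real_complex R) => x y; rewrite !inE => Bx By /= hxy.
  by apply: (@complexI R); apply: hB; rewrite ?inE.
exists (fun j => if j == i then x else g j); split=> [j|].
  by case: eqVneq => [->|].
rewrite map_rcons eqxx; have -> : [seq real_complex R (if j == i then x else g j) | j <- l] =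
    [seq real_complex R (g j) | j <- l].
  by apply/eq_in_map => j jl; case: eqVneq => // ji; rewrite -ji jl in il.
by apply/independent_rcons; rewrite set0U; split.
Qed.

Definition generic_points m t : set 'M[R]_(m, t) :=
  [set g | independent set0 [seq real_complex R (g p.1 p.2) | p <- enum {: 'I_m * 'I_t}]].

Lemma dense_generic_points m t : dense (@generic_points m t).
Proof.
move=> U [A UA] Uo.
have /nbhs_ballP[e e0 eU] : nbhs A U by apply: open_nbhs_nbhs.
have [g [gA gi]] := @independent_approx _ (fun p : 'I_m * 'I_t => A p.1 p.2) e _ e0
  (enum_uniq {: 'I_m * 'I_t}).
exists (\matrix_(i, j) g (i, j)); split.
  by apply: eU; split=> // i j; rewrite mxE; exact: gA (i, j).
rewrite /generic_points /=.
by under eq_map => p do rewrite mxE -surjective_pairing.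
Qed.
End DenseIndependent.

Lemma meval_map_comp (R : comNzRingType) (S : numFieldType)
    (f : {rmorphism R -> S}) n k
    (v : 'I_k -> S) (lq : n.-tuple {mpoly R[k]}) (p : {mpoly R[n]}) :
  meval v (map_mpoly f (comp_mpoly lq p)) =
  meval (fun i => meval v (map_mpoly f (tnth lq i))) (map_mpoly f p).
Proof.
elim/mpolyind: p => [|c m p _ _ IH]; first by rewrite !raddf0.
rewrite !raddfD /=; congr (_ + _); last exact: IH.
rewrite comp_mpolyZ !map_mpolyZ !mevalZ; congr (_ * _).
rewrite comp_mpolyX map_mpolyX mevalX !rmorph_prod; apply: eq_bigr => i _.
by rewrite /= !rmorphXn.
Qed.

(** * Transcendence degree of points of the closure, and separation by generic points *)

Section Genericity.
Variable R : realType.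
Local Notation K := (R[i]).
Local Notation ratr_K := (ratr : {rmorphism rat -> K}).

Lemma acl_rat (A : set K) q : acl A (ratr q).
Proof. by apply: acl_gen; rewrite rpred_rat. Qed.

(** At a generic point the L + 1 values are algebraic over L numbers, hence dependent; a relation
    that holds at a generic point holds identically. *)
Lemma polynomials_dependent L (w : 'I_L.+1 -> {mpoly rat[L]}) :
  exists P : {mpoly rat[L.+1]}, P != 0 /\ forall x : 'I_L -> K,
    meval (fun j => meval x (map_mpoly ratr_K (w j))) (map_mpoly ratr_K P) = 0.
Proof.
(* Only the independence matters here: the centre 0 and the radius 1 are arbitrary. *)
have [g [_ gi]] := @independent_approx R _ (fun _ : 'I_L => 0) 1 _ ltr01
  (enum_uniq 'I_L).
set xi := [seq real_complex R (g i) | i <- enum 'I_L] in gi.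
have sxi : size xi = L by rewrite size_map size_enum_ord.
pose v (i : 'I_L) := xi`_i.
pose s := [seq meval v (map_mpoly ratr_K (w j)) | j <- enum 'I_L.+1].
have ss : size s = L.+1 by rewrite size_map size_enum_ord.
have sE (i : 'I_L.+1) : s`_i = meval v (map_mpoly ratr_K (w i)).
  exact: nth_map_enum_ord.
have dep : ~ independent set0 s.
  move=> si; have := @steinitz _ _ _ xi si; rewrite ss sxi ltnn => H.
  suff : false by []; apply: H.
  move=> _ /mapP[j _ ->]; apply: acl_closed; rewrite mevalE.
  apply/QfieldP/rpred_sum => m _; apply: rpredM.
    by apply/QfieldP/generated_gen; rewrite mcoeff_map_mpoly; exact: acl_rat.
  apply: rpred_prod => i _; apply/rpredX/QfieldP/generated_gen/acl_sub; right.
  by apply: mem_nth; rewrite sxi.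
have [P [P0 Ps]] := dependent_mpoly ss dep.
exists P; split=> // x.
pose lq := mktuple w.
suff Q0 : comp_mpoly lq P = 0.
  transitivity (meval x (map_mpoly ratr_K (comp_mpoly lq P))).
    rewrite [RHS](meval_map_comp ratr_K x lq P).
    by apply: meval_eq => i; rewrite tnth_mktuple.
  by rewrite Q0 (raddf0 (map_mpoly _)) meval0.
apply/eqP; apply: contraTT isT => Q0.
have : meval v (map_mpoly ratr_K (comp_mpoly lq P)) != 0.
  apply: (independent_meval sxi gi).
    apply: contra_neq Q0 => /mpolyP Q0; apply/mpolyP => m.
    move: (Q0 m); rewrite mcoeff_map_mpoly mcoeff0 mcoeff0.
    by move/eqP; rewrite fmorph_eq0 => /eqP.
  by move=> m; rewrite mcoeff_map_mpoly; exact: acl_rat.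
rewrite meval_map_comp => /negP; case; apply/eqP; rewrite -[RHS]Ps.
by apply: meval_eq => i; rewrite tnth_mktuple sE.
Qed.

Lemma zariski_closure_vanish n (X : set 'rV[K]_n) (p : {mpoly rat[n]}) :
  (forall x, X x -> peval ratr_K p x = 0) ->
  forall z, zariski_closure ratr_K X z -> peval ratr_K p z = 0.
Proof.
move=> pX z zX; apply: (zX [set x | peval ratr_K p x = 0]); split=> //.
by exists [set p]; apply/seteqP; split=> [x px q ->|x /(_ p erefl)].
Qed.

Definition coords n (z : 'rV[K]_n) : seq K := [seq z ord0 j | j <- enum 'I_n].

(** A rational relation between L + 1 of the polynomials [w] holds on [X], hence on its Q-closure,
    which excludes L + 1 independent coordinates of [z]. *)
Lemma closure_trdeg L N (X : set 'rV[K]_N) (w : 'I_N -> {mpoly rat[L]})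
    (z : 'rV[K]_N) (B : seq K) :
  (forall x, X x -> exists y, forall j, x ord0 j = peval ratr_K (w j) y) ->
  zariski_closure ratr_K X z -> {subset B <= coords z} -> independent set0 B ->
  (size B <= L)%N.
Proof.
move=> Xw zX Bz Bi; rewrite leqNgt; apply/negP => LB.
pose B' := take L.+1 B.
have sB' : size B' = L.+1 by rewrite size_take_min; apply/minn_idPl.
have B'i : independent set0 B'.
  move=> s1 x s2 E; apply: (Bi s1 x (s2 ++ drop L.+1 B)).
  by rewrite -[LHS](cat_take_drop L.+1) -/B' E -catA.
have /choice[j jP] : forall k : 'I_L.+1, exists j, B'`_k = z ord0 j.
  move=> k; have : B'`_k \in B by apply: mem_take (mem_nth _ _); rewrite sB'.
  by move=> /Bz/mapP[j _ ->]; exists j.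
have [P [P0 Pw]] := polynomials_dependent (w \o j).
pose lq := mktuple (fun k => mpolyX rat (mnm1 (j k)) : {mpoly rat[N]}).
have Pz : peval ratr_K (comp_mpoly lq P) z = 0.
  apply: zariski_closure_vanish zX => x /Xw[y xy].
  rewrite /peval /rveval meval_map_comp -[RHS](Pw (fun i => y ord0 i)).
  by apply: meval_eq => k; rewrite tnth_mktuple map_mpolyX mevalXU xy.
move: Pz; rewrite /peval /rveval meval_map_comp => /eqP; apply/negP.
have -> : meval (fun i => meval (fun i0 => z ord0 i0) (map_mpoly ratr_K (tnth lq i))) (map_mpoly ratr_K P)
   = meval (fun i : 'I_L.+1 => B'`_i) (map_mpoly ratr_K P).
  by apply: meval_eq => k; rewrite tnth_mktuple map_mpolyX mevalXU jP.
apply: (independent_meval sB' B'i) => [|m]; last first.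
  by rewrite mcoeff_map_mpoly; exact: acl_rat.
apply: contra_neq P0 => /mpolyP Q0; apply/mpolyP => m.
move: (Q0 m); rewrite mcoeff_map_mpoly mcoeff0 mcoeff0.
by move/eqP; rewrite fmorph_eq0 => /eqP.
Qed.

(** Meant for the difference [H] of two objects whose coordinates have the transcendence bases [B1]
    and [B2]. *)
Lemma generic_separation L m t (B1 B2 : seq K) (g : 'M[R]_(m, t))
    (H : {mpoly K[t]}) :
  (2 * L < m)%N -> (size B1 <= L)%N -> (size B2 <= L)%N -> generic_points g ->
  (forall n, acl [set` B1 ++ B2] (mcoeff n H)) ->
  (forall i, meval (fun j => real_complex R (g i j)) H = 0) -> H = 0.
Proof.
move=> mL sB1 sB2 gg HB Hg; apply/eqP; apply: contraT => H0.
pose gc p : K := real_complex R (g p.1 p.2).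
pose row i := [seq gc (i, j) | j <- enum 'I_t].
have srow i : size (row i) = t by rewrite size_map size_enum_ord.
(* As a non-zero [H] vanishes at row i, the entries of that row are dependent over [B1] and [B2];
   [J i] is an entry algebraic over the others. *)
have /choice[J JP] : forall i, exists j : 'I_t, acl ([set` B1 ++ B2] `|`
    [set x | exists2 j' : 'I_t, j' != j & x = gc (i, j')]) (gc (i, j)).
  move=> i.
  have : ~ independent [set` B1 ++ B2] (row i).
    move=> /(independent_meval (srow i))/(_ H0 HB); rewrite -(Hg i) => /eqP; apply.
    by apply: meval_eq => j; exact: nth_map_enum_ord.
  move=> /existsNP[s1 /existsNP[x /existsNP[s2 /not_implyP[rE /contrapT sx]]]].
  have s1t : (size s1 < t)%N.
    by rewrite -(srow i) rE size_cat /= addnS ltnS leq_addr.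
  have xE : x = gc (i, Ordinal s1t).
    have := congr1 (nth 0 ^~ (size s1)) rE.
    rewrite nth_cat ltnn subnn /= => <-.
    exact: (nth_map_enum_ord _ _ (Ordinal s1t)).
  exists (Ordinal s1t); rewrite -xE; apply: acl_mono sx => y [By|ys1]; [by left|right].
  have ks1 : (index y s1 < size s1)%N by rewrite index_mem.
  have kt := ltn_trans ks1 s1t.
  exists (Ordinal kt); first by rewrite -val_eqE /= ltn_eqF.
  rewrite -[y in LHS](nth_index 0 ys1).
  have := congr1 (nth 0 ^~ (index y s1)) rE; rewrite nth_cat ks1 => <-.
  exact: (nth_map_enum_ord _ _ (Ordinal kt)).
pose P := [pred p : 'I_m * 'I_t | p.2 == J p.1].
(* Discarding the entry [J i] of each row leaves m t - m entries, over which, together with [B1] and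
   [B2], all of [g] is algebraic. *)
pose T := (B1 ++ B2) ++ [seq gc p | p <- enum [predC P]].
have cardP : #|P| = m.
  have inj : injective (fun i : 'I_m => (i, J i)) by move=> i j [].
  rewrite -[RHS]card_ord -(fintype.card_image inj).
  apply: eq_card => -[i j]; apply/eqP/fintype.imageP => /= [->|[k _ [-> ->]]//].
  by exists i.
have := @steinitz _ _ _ T gg; rewrite size_map -cardE card_prod !card_ord.
have -> : (size T = size B1 + size B2 + (m * t - m))%N.
  rewrite !size_cat size_map -cardE; congr (_ + _)%N.
  by have := cardC P; rewrite cardP card_prod !card_ord => <-; rewrite addKn.
have mt : (m <= m * t)%N.
  by rewrite -[leqLHS]cardP (leq_trans (max_card _))// card_prod !card_ord.
move=> le; exfalso; have : (m * t <= L + L + (m * t - m))%N.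
  apply: leq_trans (leq_add (leq_add sB1 sB2) (leqnn _)); apply: le.
  move=> _ /mapP[p _ ->]; rewrite set0U -/(gc p).
  have gT q : ~~ P q -> acl [set` T] (gc q).
    move=> Pq; apply: acl_sub; rewrite /= mem_cat; apply/orP; right.
    by apply: map_f; rewrite mem_enum.
  have [Pp|/gT//] := boolP (P p).
  have -> : p = (p.1, J p.1) by rewrite -(eqP Pp) -surjective_pairing.
  apply: acl_trans (JP p.1) => x [Bx|[j jJ ->]].
    by apply: acl_sub; rewrite /= mem_cat Bx.
  by apply: gT; rewrite /= .
rewrite addnBA// leq_subRL; last by rewrite (leq_trans mt)// leq_addl.
by rewrite leq_add2r leqNgt addnn -mul2n mL.
Qed.

End Genericity.

(** * Projections of closed cones *)

Section ZariskiTopology.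
Variable K : numClosedFieldType.

Notation zclosed := (zariski_closed (idfun : {rmorphism K -> K})).
Notation widen := (widen_ord (leqnSn _)).

Lemma peval_idfun n (p : {mpoly K[n]}) (x : 'rV[K]_n) :
  peval (idfun : {rmorphism K -> K}) p x = rveval p x.
Proof.
rewrite /peval; congr rveval.
by apply/mpolyP => m; rewrite mcoeff_map_mpoly.
Qed.

(** A closed set is the zero set of its own vanishing ideal; no equations need to be chosen. *)
Lemma zclosedP n (X : set 'rV[K]_n) : zclosed X <->
  forall x, (forall p, (forall y, X y -> rveval p y = 0) -> rveval p x = 0) -> X x.
Proof.
split=> [[P ->] x H p Pp|H].
  by rewrite peval_idfun; apply: H => y /(_ p Pp); rewrite peval_idfun.
exists [set p | forall y, X y -> rveval p y = 0].
apply/seteqP; split=> [x Xx p Pp|x Hx]; first by rewrite peval_idfun; exact: Pp.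
by apply: H => p Xp; rewrite -peval_idfun; exact: Hx.
Qed.

Lemma zclosed_zeros n I (D : set I) (p : I -> {mpoly K[n]}) :
  zclosed [set x | forall i, D i -> rveval (p i) x = 0].
Proof.
by apply/zclosedP => x H i Di; apply: H => y; exact.
Qed.

Lemma zclosed_zero n (p : {mpoly K[n]}) : zclosed [set x | rveval p x = 0].
Proof. by apply/zclosedP => x; apply. Qed.

Lemma zclosedI n (X Y : set 'rV[K]_n) : zclosed X -> zclosed Y -> zclosed (X `&` Y).
Proof.
move=> /zclosedP Xc /zclosedP Yc; apply/zclosedP => x H.
by split; [apply: Xc|apply: Yc] => p pX; apply: H => y [? ?]; exact: pX.
Qed.

Lemma rveval_comp n k (w : 'I_n -> {mpoly K[k]}) (p : {mpoly K[n]}) :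
  {q : {mpoly K[k]} | forall x, rveval q x = rveval p (\row_i rveval (w i) x)}.
Proof.
exists (comp_mpoly (mktuple w) p) => x.
rewrite /rveval comp_mpoly_meval; apply: meval_eq => i.
by rewrite tnth_mktuple mxE.
Qed.

Lemma zclosed_preimage n k (w : 'I_n -> {mpoly K[k]}) (X : set 'rV[K]_n) :
  zclosed X -> zclosed [set x | X (\row_i rveval (w i) x)].
Proof.
move=> /zclosedP Xc; apply/zclosedP => x H; apply: Xc => p pX.
by have [q qE] := rveval_comp w p; rewrite -qE; apply: H => y; rewrite qE; exact: pX.
Qed.

Definition linform n (c : 'cV[K]_n) : {mpoly K[n]} :=
  \sum_(i < n) c i ord0 *: mpolyX K (mnm1 i).

Lemma rveval_linform n (c : 'cV[K]_n) x : rveval (linform c) x = (x *m c) ord0 ord0.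
Proof.
rewrite /rveval /linform raddf_sum mxE; apply: eq_bigr => i _ /=.
by rewrite mevalZ mevalXU mulrC.
Qed.

Lemma mulmx_linform n k (M : 'M[K]_(n, k)) x :
  x *m M = \row_j rveval (linform (col j M)) x.
Proof.
apply/rowP => j; rewrite [RHS]mxE rveval_linform !mxE.
by apply: eq_bigr => i _; rewrite !mxE.
Qed.

Lemma rveval_linform_col n k (M : 'M[K]_(n, k)) j x :
  rveval (linform (col j M)) x = (x *m M) ord0 j.
Proof. by rewrite [in RHS]mulmx_linform mxE. Qed.

Lemma rveval_mulmx n k (M : 'M[K]_(k, n)) (p : {mpoly K[n]}) :
  {q : {mpoly K[k]} | forall x, rveval q x = rveval p (x *m M)}.
Proof.
have [q qE] := rveval_comp (fun j => linform (col j M)) p.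
by exists q => x; rewrite qE mulmx_linform.
Qed.

Lemma zclosed_mulmx_preimage n k (M : 'M[K]_(k, n)) (X : set 'rV[K]_n) :
  zclosed X -> zclosed [set x | X (x *m M)].
Proof.
move=> /(zclosed_preimage (fun j => linform (col j M))).
by congr zclosed; apply/seteqP; split=> x /=; rewrite mulmx_linform.
Qed.

Definition snoc n (y : 'rV[K]_n) (t : K) : 'rV[K]_n.+1 :=
  \row_i oapp (y ord0) t (unlift ord_max i).

Lemma snoc_max n (y : 'rV[K]_n) t : snoc y t ord0 ord_max = t.
Proof. by rewrite mxE unlift_none. Qed.

Lemma widen_lift n (i : 'I_n) : widen i = lift ord_max i.
Proof. by apply: val_inj; rewrite /= /bump leqNgt ltn_ord. Qed.

Lemma snoc_widen n (y : 'rV[K]_n) t i : snoc y t ord0 (widen i) = y ord0 i.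
Proof. by rewrite mxE widen_lift liftK. Qed.

Lemma snoc_inj n (y y' : 'rV[K]_n) t t' : snoc y t = snoc y' t' -> y = y' /\ t = t'.
Proof.
move=> E; split; last by rewrite -(snoc_max y t) E snoc_max.
by apply/rowP => i; rewrite -(snoc_widen y t) E snoc_widen.
Qed.

Definition snocmx n k (M : 'M[K]_(n, k)) (c : 'cV[K]_n) : 'M[K]_(n, k.+1) :=
  \matrix_(i, j) oapp (M i) (c i ord0) (unlift ord_max j).

Lemma mul_snocmx n k (M : 'M[K]_(n, k)) (c : 'cV[K]_n) x :
  x *m snocmx M c = snoc (x *m M) ((x *m c) ord0 ord0).
Proof.
apply/rowP => j; case: (unliftP ord_max j) => [i ->|->].
  rewrite -widen_lift snoc_widen !mxE; apply: eq_bigr => l _.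
  by rewrite mxE widen_lift liftK.
rewrite snoc_max !mxE; apply: eq_bigr => l _.
by rewrite mxE unlift_none.
Qed.

(** The restriction of a function on affine (n+1)-space to the line over [y]. *)
Definition spec n (y : 'rV[K]_n) (q : {poly {mpoly K[n]}}) : {poly K} :=
  map_poly (meval (fun i => y ord0 i)) q.

Lemma specB n (y : 'rV[K]_n) p q : spec y (p - q) = spec y p - spec y q.
Proof. exact: rmorphB. Qed.

Lemma specD n (y : 'rV[K]_n) p q : spec y (p + q) = spec y p + spec y q.
Proof. exact: rmorphD. Qed.

Lemma spec0 n (y : 'rV[K]_n) : spec y 0 = 0.
Proof. exact: rmorph0. Qed.

Lemma specM n (y : 'rV[K]_n) p q : spec y (p * q) = spec y p * spec y q.
Proof. exact: rmorphM. Qed.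

Lemma coef_spec n (y : 'rV[K]_n) q i : (spec y q)`_i = rveval q`_i y.
Proof. by rewrite coef_map. Qed.

Lemma specC n (y : 'rV[K]_n) p : spec y p%:P = (rveval p y)%:P.
Proof. by rewrite /spec map_polyC. Qed.

Lemma rveval_snoc n (p : {mpoly K[n.+1]}) y t :
  rveval p (snoc y t) = (spec y (muni p)).[t].
Proof.
rewrite /rveval meval_muni snoc_max; congr (_.[_]).
by apply: eq_map_poly => q; apply: meval_eq => i /=; rewrite snoc_widen.
Qed.

(* {poly {mpoly K[n]}} is the coordinate ring of affine (n+1)-space. *)
Definition vanishing n (X : set 'rV[K]_n.+1) : set {poly {mpoly K[n]}} :=
  [set q | forall y t, X (snoc y t) -> (spec y q).[t] = 0].

Lemma vanishingB n (X : set 'rV[K]_n.+1) p q :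
  vanishing X p -> vanishing X q -> vanishing X (p - q).
Proof. by move=> pX qX y t Xyt; rewrite specB hornerD hornerN pX// qX// subr0. Qed.

Lemma vanishingM n (X : set 'rV[K]_n.+1) p q : vanishing X q -> vanishing X (p * q).
Proof. by move=> qX y t Xyt; rewrite specM hornerM qX// mulr0. Qed.

Lemma vanishing_closed n (X : set 'rV[K]_n.+1) y t : zclosed X ->
  (forall q, vanishing X q -> (spec y q).[t] = 0) -> X (snoc y t).
Proof.
move=> /zclosedP Xc H; apply: Xc => p pX; rewrite rveval_snoc; apply: H => y' t'.
by rewrite -rveval_snoc; exact: pX.
Qed.

(** A non-zero element of minimal size generates, by Euclidean division. *)
Lemma ideal_generator (J : set {poly K}) f :
  J f -> f != 0 -> (forall p q, J p -> J q -> J (p - q)) ->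
  (forall p q, J q -> J (p * q)) ->
  exists g, [/\ J g, g != 0 & forall h, J h -> g %| h].
Proof.
move=> Jf f0 JB JM.
pose P n := `[< exists g, [/\ J g, g != 0 & size g = n] >].
have exP : exists n, P n by exists (size f); apply/asboolP; exists f.
case: (ex_minnP exP) => n /asboolP[g [Jg g0 sg]] nmin.
exists g; split=> // h Jh; rewrite -[_ %| _]/(h %% g == 0).
apply: contraT => hg0.
have : P (size (h %% g)).
  apply/asboolP; exists (h %% g); split=> //.
  rewrite (_ : h %% g = h - h %/ g * g); first by apply: JB => //; exact: JM.
  by rewrite {2}(divp_eq h g) addrAC subrr add0r.
by move=> /nmin; rewrite -sg leqNgt ltn_modp g0.
Qed.

(** Specialisation at [y] maps the vanishing ideal onto an ideal of K[T], as polynomials over [K]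
    lift with constant coefficients; it is not zero, because [f] stays monic. *)
Lemma vanishing_generator n (X : set 'rV[K]_n.+1) f y :
  vanishing X f -> f \is monic ->
  exists g, [/\ vanishing X g, spec y g != 0 &
    forall h, vanishing X h -> spec y g %| spec y h].
Proof.
move=> Xf mf.
have [||a b [p Xp <-] [q Xq <-]|p a [q Xq <-]|_ [[g Xg <-] g0 gmin]] :=
    @ideal_generator [set spec y g | g in vanishing X] (spec y f).
- by exists f.
- by rewrite monic_neq0// monic_map.
- by exists (p - q); [exact: vanishingB|rewrite specB].
- exists (map_poly (@mpolyC n K) p * q); first exact: vanishingM.
  rewrite specM; congr (_ * _); apply/polyP => i.
  by rewrite coef_spec coef_map /rveval mevalC.
by exists g; split=> // h Xh; apply: gmin; exists h.
Qed.

(* The determinant of multiplication by q modulo f is a polynomial in y that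
   vanishes wherever the specialisations of f and q have a common root. *)
Lemma zclosed_projection n (X : set 'rV[K]_n.+1) f :
  zclosed X -> vanishing X f -> f \is monic ->
  zclosed [set y | exists t, X (snoc y t)].
Proof.
move=> Xc Xf mf; apply/zclosedP => y Hy.
have [g [Xg g0 gmin]] := vanishing_generator y Xf mf.
(* If the generator over [y] is not constant, any root [t] of it satisfies all the relations, so
   that (y, t) lies in [X]. *)
have [/size_poly1P[c c0 gc]|] := boolP (size (spec y g) == 1%N); last first.
  move=> /closed_rootP[t gt]; exists t; apply: vanishing_closed => // q /gmin/dvdpP[u ->].
  by rewrite hornerM (rootP gt) mulr0.
(* The companion matrix needs a positive size. In degree 0, [f] is 1 and [X] is empty. *)
case sf: (size f).-1 => [|d].
  have f1 : f = 1.
    have /size1_polyC fE : (size f <= 1)%N by rewrite -subn_eq0 subn1 sf.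
    by move: mf; rewrite fE monicE lead_coefC => /eqP ->.
  suff : rveval 1 y = 0 by rewrite /rveval meval1 => /eqP; rewrite oner_eq0.
  by apply: Hy => z [t /Xf]; rewrite f1 /spec rmorph1 hornerC => /eqP; rewrite oner_eq0.
have [A Af] : exists A : 'M[{mpoly K[n]}]_d.+1, char_poly A = f.
  by move: (companionmx f) (companionmxK mf); rewrite sf => A; exists A.
have detE z : rveval (\det (horner_mx A g)) z =
    \det (horner_mx (map_mx (meval (fun i => z ord0 i)) A) (spec z g)).
  by rewrite /rveval -det_map_mx map_horner_mx.
(* Over [y] the generator is a constant c, so this determinant is the non-zero power c^(d+1). *)
suff : rveval (\det (horner_mx A g)) y = 0.
  rewrite detE gc horner_mx_C det_scalar => /eqP.
  by rewrite expf_eq0 (negPf c0) andbF.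
apply: Hy => z [t zt]; rewrite detE; set B := map_mx _ A.
(* The root t of [f] over z is an eigenvalue of the companion matrix, and g acts on its eigenvector
   as multiplication by g(t) = 0. *)
have : eigenvalue B t.
  rewrite eigenvalue_root_char -map_char_poly Af; apply/rootP; exact: Xf zt.
move=> /eigenvalueP[v vB v0]; apply/eqP/det0P; exists v => //.
have -> : v *m horner_mx B (spec z g) = (spec z g).[t] *: v.
  elim/poly_ind: (spec z g) => [|p a IH].
    by rewrite rmorph0 mulmx0 horner0 scale0r.
  rewrite rmorphD rmorphM /= horner_mx_X horner_mx_C mulmxDr mulmxA IH.
  by rewrite -scalemxAl vB mul_mx_scalar hornerMXaddC scalerDl scalerA.
by rewrite Xg// scale0r.
Qed.

End ZariskiTopology.

(** * Homogeneous parts of the polynomials vanishing on a cone *)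

Section HomogeneousParts.
Variables (k : fieldType) (K : numClosedFieldType) (iota : {rmorphism k -> K}).

Definition hpart n d (p : {mpoly k[n]}) : {mpoly k[n]} :=
  \sum_(m <- msupp p | mdeg m == d) mcoeff m p *: mpolyX k m.

Lemma pevalE n (p : {mpoly k[n]}) (x : 'rV[K]_n) :
  peval iota p x =
  \sum_(m <- msupp p) iota (mcoeff m p) * \prod_i x ord0 i ^+ m i.
Proof.
rewrite /peval /rveval mevalE (perm_big _ (msupp_map_mpoly _ (fmorph_inj _))) /=.
by apply: eq_bigr => m _; rewrite mcoeff_map_mpoly.
Qed.

Lemma peval_hpart n d (p : {mpoly k[n]}) (x : 'rV[K]_n) :
  peval iota (hpart d p) x =
  \sum_(m <- msupp p | mdeg m == d) iota (mcoeff m p) * \prod_i x ord0 i ^+ m i.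
Proof.
rewrite /peval /rveval /hpart (raddf_sum (map_mpoly _)) (raddf_sum (meval _)).
by apply: eq_bigr => m _; rewrite /= map_mpolyZ map_mpolyX mevalZ mevalX.
Qed.

Lemma peval_scale n (p : {mpoly k[n]}) a (x : 'rV[K]_n) :
  peval iota p (a *: x) =
  \sum_(d < msize p) a ^+ d * peval iota (hpart d p) x.
Proof.
rewrite pevalE; under [RHS]eq_bigr do rewrite peval_hpart big_distrr /=.
rewrite (exchange_big_dep predT)//= big_seq [RHS]big_seq; apply: eq_bigr => m mp.
rewrite (big_pred1 (Ordinal (msize_mdeg_lt mp))); last first.
  by move=> i; rewrite /= -val_eqE eq_sym.
rewrite /= mulrCA; congr (_ * _); rewrite mdegE -prodrXr -big_split /=.
by apply: eq_bigr => i _; rewrite mxE exprMn.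
Qed.

(** Along the line through [x], p(a x) is a polynomial in a whose coefficients are the values of the
    homogeneous parts; it vanishes for all a. *)
Lemma cone_hpart n (X : set 'rV[K]_n) (p : {mpoly k[n]}) :
  (forall a x, X x -> X (a *: x)) -> (forall x, X x -> peval iota p x = 0) ->
  forall d x, X x -> peval iota (hpart d p) x = 0.
Proof.
move=> coneX Xp d x Xx; have [dp|pd] := ltnP d (msize p); last first.
  rewrite peval_hpart big_seq_cond big1// => m /andP[mp /eqP dm].
  by have := msize_mdeg_lt mp; rewrite dm ltnNge pd.
pose q := \poly_(d < msize p) peval iota (hpart d p) x.
suff q0 : q = 0 by have := coef0 K d; rewrite -q0 coef_poly dp.
apply/eqP; apply: contraT => /poly_nonroot[a /negP[]]; apply/rootP.
rewrite horner_poly -[RHS](Xp _ (coneX a _ Xx)) peval_scale.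
by apply: eq_bigr => i _; rewrite mulrC.
Qed.

End HomogeneousParts.

(** * Monic relations on a cone that misses the centre of projection *)

Section ConeProjection.
Variable K : numClosedFieldType.
Notation zclosed := (zariski_closed (idfun : {rmorphism K -> K})).

Lemma meval_at0 n (p : {mpoly K[n]}) : rveval p 0 = mcoeff (@mnm0 n) p.
Proof.
rewrite /rveval; elim/mpolyind: p => [|c m p _ _ IH].
  by rewrite meval0 mcoeff0.
rewrite mevalD mcoeffD; congr (_ + _); last exact: IH.
rewrite mevalZ mcoeffZ mevalX mcoeffX; congr (_ * _).
have [->|m0] := eqVneq m (@mnm0 n).
  by rewrite big1// => i _; rewrite mnm0E expr0.
suff [i mi] : exists i, m i != 0%N.
  by rewrite (bigD1 i)//= mxE expr0n (negPf mi) mul0r.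
apply: contrapT => mi; move/eqP: m0; apply; apply/mnmP => i; rewrite mnm0E.
by apply/eqP; apply: contraT => mi0; exfalso; apply: mi; exists i.
Qed.

Lemma mdeg_rcons n (m : multinom n) i :
  mdeg (Multinom (rcons_tuple m i)) = (mdeg m + i)%N.
Proof.
rewrite !mdegE big_ord_recr /= multinom_rcons_max; congr (_ + _)%N.
by apply: eq_bigr => j _; rewrite multinom_rcons_widen.
Qed.

Lemma mcoeff_hpart n d (p : {mpoly K[n]}) m :
  mdeg m != d -> mcoeff m (hpart d p) = 0.
Proof.
move=> md; rewrite /hpart (raddf_sum (mcoeff m)) /= big1// => m' /eqP m'd.
rewrite mcoeffZ mcoeffX; case: eqP => [m'm|_]; last by rewrite mulr0.
by rewrite -m'm m'd eqxx in md.
Qed.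

(** A form of degree d that vanishes on [X] but not at the centre (0, ..., 0, 1) has degree d in the
    last variable, with a constant leading coefficient: its value at the centre. *)
Lemma cone_vanishing_monic n (X : set 'rV[K]_n.+1) :
  zclosed X -> (forall a x, X x -> X (a *: x)) -> ~ X (snoc 0 1) ->
  exists f, vanishing X f /\ f \is monic.
Proof.
move=> /zclosedP Xc coneX nX.
have [p [Xp p1]] : exists p, (forall x, X x -> rveval p x = 0) /\ rveval p (snoc 0 1) != 0.
  apply: contrapT => np; apply: nX; apply: Xc => p Xp; apply/eqP.
  by apply: contraT => p1; exfalso; apply: np; exists p.
have [d hd] : exists d, rveval (hpart d p) (snoc 0 1) != 0.
  apply: contrapT => nd; move/eqP: p1; apply.
  rewrite -peval_idfun -[snoc 0 1]scale1r peval_scale big1// => i _.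
  rewrite peval_idfun; have [->|h] := eqVneq (rveval (hpart i p) (snoc 0 1)) 0.
    by rewrite mulr0.
  by exfalso; apply: nd; exists (i : nat).
pose q := muni (hpart d p).
have qE i m : (mdeg m + i != d)%N -> mcoeff m q`_i = 0.
  by move=> md; rewrite mcoeff_muni mcoeff_hpart// mdeg_rcons.
have q_gt i : (d < i)%N -> q`_i = 0.
  move=> di; apply/mpolyP => m; rewrite mcoeff0 qE// gtn_eqF//.
  by rewrite (leq_trans di)// leq_addl.
have sq : (size q <= d.+1)%N.
  by apply/leq_sizeP => i; exact: q_gt.
pose c := mcoeff (@mnm0 n) q`_d.
have qd : q`_d = mpolyC n c.
  apply/mpolyP => m; rewrite mcoeffC; have [<-|m0] := eqVneq (@mnm0 n) m.
    by rewrite mulr1.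
  rewrite mulr0 qE//; apply: contra_neq m0 => /eqP.
  by rewrite -[X in _ == X]add0n eqn_add2r mdeg_eq0 => /eqP.
have c0 : c != 0.
  move: hd; rewrite rveval_snoc -/q (@horner_coef_wide _ d.+1); last first.
    exact: leq_trans (size_poly _ _) sq.
  rewrite big_ord_recr /= big1 ?add0r => [|i _].
    by rewrite coef_spec meval_at0 expr1n mulr1.
  by rewrite coef_spec meval_at0 qE ?mul0r// mdeg0 add0n ltn_eqF.
exists (mpolyC n c^-1 *: q); split.
  move=> y t Xyt; rewrite -mul_polyC specM hornerM -rveval_snoc.
  rewrite -(peval_idfun (hpart d p)) (@cone_hpart _ _ _ _ X) ?mulr0// => x Xx.
  by rewrite peval_idfun; exact: Xp.
have fd : (mpolyC n c^-1 *: q)`_d = 1.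
  by rewrite coefZ qd -mpolyCM mulVf.
have sf : size (mpolyC n c^-1 *: q) = d.+1.
  apply/eqP; rewrite eqn_leq (leq_trans (size_scale_leq _ _) sq) /= ltnNge.
  by apply/negP => /leq_sizeP/(_ _ (leqnn _))/eqP; rewrite fd oner_eq0.
by rewrite monicE lead_coefE sf /= fd.
Qed.

End ConeProjection.

(** * Linear maps whose kernel meets a closed cone at most in 0 *)

Section ConeMap.
Variable K : numClosedFieldType.
Notation zclosed := (zariski_closed (idfun : {rmorphism K -> K})).
Variables (N : nat) (X : set 'rV[K]_N).
Hypotheses (Xc : zclosed X) (coneX : forall a x, X x -> X (a *: x)).

(** Both properties are passed on together when a column is dropped. A finite index type is
    convenient as the generators are then multiplied by powers. *)
Definition closed_finite n (M : 'M[K]_(N, n)) :=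
  (forall Z, zclosed Z -> Z `<=` X -> zclosed [set x *m M | x in Z]) /\
  exists (I : finType) (g : I -> {mpoly K[N]}), forall p : {mpoly K[N]},
    exists h : I -> {mpoly K[n]}, forall x, X x ->
      rveval p x = \sum_i rveval (h i) (x *m M) * rveval (g i) x.

(** An injective [M] has the right inverse [pinvmx M], and its image is cut out by the linear
    equations y M' M = y, where M' is this inverse. *)
Lemma injective_closed_finite n (M : 'M[K]_(N, n)) :
  (forall x : 'rV_N, x *m M = 0 -> x = 0) -> closed_finite M.
Proof.
move=> M0.
have MG : M *m pinvmx M = 1%:M.
  apply: mulmxVp; rewrite -kermx_eq0; apply/eqP/row_matrixP => i.
  by rewrite row0; apply: M0; rewrite -row_mul mulmx_ker row0.
have MK x : x *m M *m pinvmx M = x by rewrite -mulmxA MG mulmx1.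
split=> [Z Zc ZX|].
  have -> : [set x *m M | x in Z] = [set y | Z (y *m pinvmx M)] `&`
      [set y | forall j, [set: 'I_n] j -> rveval (linform (col j (pinvmx M *m M - 1%:M))) y = 0].
    apply/seteqP; split=> [_ [x Zx <-]|y [Zy Hy]].
      split=> [|j _]; rewrite /= ?MK// rveval_linform_col mulmxBr mulmx1.
      by rewrite mulmxA MK subrr mxE.
    exists (y *m pinvmx M) => //; apply/eqP; rewrite -subr_eq0; apply/eqP/rowP => j.
    by have := Hy j I; rewrite rveval_linform_col mulmxBr mulmx1 mulmxA => ->; rewrite mxE.
  apply: zclosedI; first exact: zclosed_mulmx_preimage.
  exact: zclosed_zeros.
exists unit, (fun=> 1) => p; have [q qE] := rveval_mulmx (pinvmx M) p.
exists (fun=> q) => x Xx; rewrite big_const card_unit /= addr0 qE MK.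
by rewrite /rveval meval1 mulr1.
Qed.

(** If the centre were an image, it would be that of some [x] in [X] killed by [M], hence of 0,
    whose last coordinate is 0 and not 1. *)
Lemma snocmx_monic n (M : 'M[K]_(N, n)) (c : 'cV[K]_N) :
  zclosed [set x *m snocmx M c | x in X] ->
  (forall x, X x -> x *m M = 0 -> x = 0) ->
  exists f, vanishing [set x *m snocmx M c | x in X] f /\ f \is monic.
Proof.
move=> Yc M0; apply: cone_vanishing_monic => //.
  by move=> a _ [x Xx <-]; exists (a *: x); [exact: coneX|rewrite scalemxAl].
move=> [x Xx]; rewrite mul_snocmx => /snoc_inj[xM xc].
by move/eqP: xc; rewrite (M0 _ Xx xM) mul0mx mxE eq_sym oner_eq0.
Qed.

(** The dropped coordinate satisfies a monic equation [f]: images stay closed by elimination, and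
    reduction modulo [f] leaves only its powers below the degree of [f] as new generators. *)
Lemma drop_column_closed_finite n (M : 'M[K]_(N, n)) (c : 'cV[K]_N) :
  closed_finite (snocmx M c) ->
  (forall x, X x -> x *m M = 0 -> x = 0) -> closed_finite M.
Proof.
move=> [Mcl [I [g gP]]] M0.
have [f [Xf mf]] := snocmx_monic (Mcl X Xc (fun _ => id)) M0.
split=> [Z Zc ZX|].
  have Zf : vanishing [set x *m snocmx M c | x in Z] f.
    by move=> y t [x Zx E]; apply: Xf; exists x => //; exact: ZX.
  rewrite (_ : [set _ | _ in _] =
      [set y | exists t, [set x *m snocmx M c | x in Z] (snoc y t)]).
    exact: zclosed_projection (Mcl _ Zc ZX) Zf mf.
  apply/seteqP; split=> [_ [x Zx <-]|y [t [x Zx]]].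
    by exists ((x *m c) ord0 ord0), x => //; rewrite mul_snocmx.
  by rewrite mul_snocmx => /snoc_inj[<- _]; exists x.
pose d := (size f).-1.
exists (I * 'I_d)%type, (fun ij : I * 'I_d => linform c ^+ ij.2 * g ij.1) => p.
have [h hP] := gP p.
pose r i := Pdiv.Ring.rmodp (muni (h i)) f.
exists (fun ij : I * 'I_d => (r ij.1)`_ij.2) => x Xx.
rewrite (hP x Xx) -(pair_bigA _ (fun i (j : 'I_d) => rveval (r i)`_j (x *m M) *
  rveval (linform c ^+ j * g i) x)) /=.
apply: eq_bigr => i _; rewrite mul_snocmx rveval_snoc.
rewrite [X in spec _ X](Pdiv.RingMonic.rdivp_eq mf) -/(r i).
have -> : (spec (x *m M) (Pdiv.Ring.rdivp (muni (h i)) f * f + r i)).[(x *m c) ord0 ord0] =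
    (spec (x *m M) (r i)).[(x *m c) ord0 ord0].
  rewrite specD hornerD (vanishingM _ Xf) ?add0r//.
  by exists x => //; rewrite mul_snocmx.
rewrite (@horner_coef_wide _ d); last first.
  rewrite (leq_trans (size_poly _ _))// /d -ltnS prednK.
    by rewrite Pdiv.Ring.ltn_rmodpN0 ?monic_neq0.
  by rewrite size_poly_gt0 monic_neq0.
rewrite big_distrl; apply: eq_bigr => j _ /=.
by rewrite coef_spec /rveval mevalM rmorphXn /= -!/(rveval _ _) rveval_linform mulrA.
Qed.

Lemma cone_closed_finite n (M : 'M[K]_(N, n)) :
  (forall x, X x -> x *m M = 0 -> x = 0) -> closed_finite M.
Proof.
(* Induction on the number k of coordinates that make the map injective when joined to it. For k = N
   this is no condition; for k = 0 the map itself is injective. *)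
suff main k n' (M' : 'M[K]_(N, n')) :
    (forall x, X x -> x *m M' = 0 -> x = 0) ->
    (forall x : 'rV_N, x *m M' = 0 -> (forall j : 'I_N, (j < k)%N -> x ord0 j = 0) -> x = 0) ->
    closed_finite M'.
  by move=> M0; apply: (main N) => // x _ x0; apply/rowP => j; rewrite x0 ?mxE.
elim: k n' M' => [|k IH] n' M' M0 Mk.
  by apply: injective_closed_finite => x xM; apply: Mk.
have [Nk|kN] := leqP N k.
  by apply: IH => // x xM x0; apply: Mk => // j _; apply: x0; exact: leq_trans Nk.
pose e : 'cV[K]_N := delta_mx (Ordinal kN) ord0.
have xe (x : 'rV_N) : (x *m e) ord0 ord0 = x ord0 (Ordinal kN).
  by rewrite -colE mxE.
apply: (@drop_column_closed_finite _ _ e) => //; apply: IH => [x Xx|x].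
  rewrite mul_snocmx => /rowP H; apply: M0 => //; apply/rowP => j.
  by have := H (widen_ord (leqnSn _) j); rewrite snoc_widen !mxE.
rewrite mul_snocmx xe => /rowP H xk.
have xM : x *m M' = 0.
  by apply/rowP => j; have := H (widen_ord (leqnSn _) j); rewrite snoc_widen !mxE.
have xk0 : x ord0 (Ordinal kN) = 0.
  by have := H ord_max; rewrite snoc_max mxE.
apply: Mk => // j; rewrite ltnS leq_eqVlt => /predU1P[jk|/xk//].
by rewrite -xk0; congr (x _ _); apply: val_inj.
Qed.

End ConeMap.

(** * The rational inverse of the linear map on a closed subset of the cone *)

Section GenericInverse.
Variable K : numClosedFieldType.
Notation zclosed := (zariski_closed (idfun : {rmorphism K -> K})).
Variables (N : nat) (X : set 'rV[K]_N).
Hypotheses (Xc : zclosed X) (coneX : forall a x, X x -> X (a *: x)).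
Variables (n : nat) (M : 'M[K]_(N, n)).
Hypothesis M0 : forall x, X x -> x *m M = 0 -> x = 0.

Let coord_col k : 'cV[K]_N := delta_mx k ord0.

Lemma mul_coord_col (x : 'rV[K]_N) k : (x *m coord_col k) ord0 ord0 = x ord0 k.
Proof. by rewrite -colE mxE. Qed.

Lemma snoc_coord_image Z k y t :
  [set x *m snocmx M (coord_col k) | x in Z] (snoc y t) <->
  exists x, [/\ Z x, x *m M = y & x ord0 k = t].
Proof.
split=> [[x Zx]|[x [Zx <- <-]]]; last by exists x; rewrite ?mul_snocmx ?mul_coord_col.
by rewrite mul_snocmx mul_coord_col => /snoc_inj[<- <-]; exists x.
Qed.

Lemma snoc_coord_closed Z k : zclosed Z -> Z `<=` X ->
  zclosed [set x *m snocmx M (coord_col k) | x in Z].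
Proof.
move=> Zc ZX; suff [+ _] : closed_finite X (snocmx M (coord_col k)) by exact.
apply: cone_closed_finite => // x Xx /rowP H; apply: M0 => //; apply/rowP => j.
by have := H (widen_ord (leqnSn _) j); rewrite mul_snocmx snoc_widen !mxE.
Qed.

Lemma snoc_coord_monic k : exists f,
  vanishing [set x *m snocmx M (coord_col k) | x in X] f /\ f \is monic.
Proof. by apply: snocmx_monic => //; exact: snoc_coord_closed. Qed.

(* All roots of a relation of minimal degree between x_k and x *m M lie in the
   fibre, which is a singleton: the relation is a power of a linear one, and x_k
   is read off its two leading coefficients. *)
Lemma generic_inverse (C : set 'rV[K]_N) k :
  zclosed C -> C `<=` X -> C !=set0 ->
  (forall x x', C x -> C x' -> x *m M = x' *m M -> x = x') ->
  exists a b : {mpoly K[n]}, (exists2 x, C x & rveval a (x *m M) != 0) /\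
    forall x, C x -> rveval a (x *m M) != 0 ->
      x ord0 k = rveval b (x *m M) / rveval a (x *m M).
Proof.
move=> Cc CX [x0 Cx0] Cinj.
pose Y := [set x *m snocmx M (coord_col k) | x in C].
have Yc : zclosed Y by exact: snoc_coord_closed.
have [f [Xf mf]] := snoc_coord_monic k.
have Yf : vanishing Y f.
  by move=> y t [x Cx E]; apply: Xf; exists x => //; exact: CX.
have YE g x : vanishing Y g -> C x -> (spec (x *m M) g).[x ord0 k] = 0.
  by move=> Yg Cx; apply: Yg; apply/snoc_coord_image; exists x.
pose P s := `[< exists g, [/\ vanishing Y g, size g = s &
  exists2 x, C x & rveval (lead_coef g) (x *m M) != 0] >].
have exP : exists s, P s.
  exists (size f); apply/asboolP; exists f; split=> //; exists x0 => //.
  by rewrite (eqP mf) /rveval meval1 oner_neq0.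
case: (ex_minnP exP) => s /asboolP[g [Yg sg [x1 Cx1 gx1]]] smin.
(* By minimality the leading coefficient of a smaller relation vanishes on the image of [C]; the
   leading term can be removed and the argument repeated. *)
have small h : vanishing Y h -> (size h < size g)%N ->
    forall x, C x -> spec (x *m M) h = 0.
  have [m] := ubnP (size h); elim: m h => // m IH h; rewrite ltnS => hm Yh hg x Cx.
  have [->|h0] := eqVneq h 0; first by rewrite spec0.
  have lh y : C y -> rveval (lead_coef h) (y *m M) = 0.
    move=> Cy; apply/eqP; apply: contraTT hg => hy; rewrite -leqNgt sg.
    by apply: smin; apply/asboolP; exists h; split=> //; exists y.
  pose h' := h - (lead_coef h)%:P * 'X^((size h).-1).
  have Yh' : vanishing Y h'.
    apply: vanishingB => // y t /snoc_coord_image[z [Cz <- <-]].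
    by rewrite specM specC lh// mul0r horner0.
  have sh' : (size h' < size h)%N.
    rewrite -[X in (_ < X)%N]prednK ?size_poly_gt0// ltnS; apply/leq_sizeP => j.
    rewrite coefB coefCM coefXn leq_eqVlt => /predU1P[<-|hj].
      by rewrite eqxx mulr1 -lead_coefE subrr.
    rewrite gtn_eqF// mulr0 subr0 nth_default//.
    by move: hj; rewrite prednK ?size_poly_gt0.
  have -> : h = h' + (lead_coef h)%:P * 'X^((size h).-1) by rewrite subrK.
  rewrite specD (IH h' (leq_trans sh' hm) Yh' (ltn_trans sh' hg) _ Cx).
  by rewrite specM specC lh// mul0r addr0.
have fibre x t : C x -> rveval (lead_coef g) (x *m M) != 0 ->
    root (spec (x *m M) g) t -> t = x ord0 k.
  move=> Cx gx gt; suff /snoc_coord_image[x' [Cx' E <-]] : Y (snoc (x *m M) t).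
    by rewrite (Cinj _ _ Cx' Cx E).
  apply: vanishing_closed => // h Yh.
  (* Pseudo-division multiplies [h] by a power [c] of the leading coefficient of [g], which is not
     zero over [x], and the remainder vanishes over [C] by [small]. Thus [h] vanishes at the root
     [t] of [g]. *)
  have hE := Pdiv.Idomain.divp_eq h g.
  set c := lead_coef g ^+ _ in hE; set r := (h %% g) in hE.
  have Yr : vanishing Y r.
    have -> : r = c%:P * h - h %/ g * g.
      by rewrite mul_polyC hE addrAC subrr add0r.
    by apply: vanishingB; exact: vanishingM.
  have g0 : g != 0.
    by apply: contraNneq gx => ->; rewrite lead_coef0 /rveval meval0.
  have := congr1 (fun q => (spec (x *m M) q).[t]) hE.
  rewrite specD (small r)// ?addr0; last first.
    by rewrite ltn_modp.
  rewrite -mul_polyC !specM !hornerM (rootP gt) mulr0 specC hornerC => /eqP.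
  rewrite mulf_eq0 /c /rveval rmorphXn /= -/(rveval _ _) expf_eq0 (negPf gx) andbF /=.
  by move=> /eqP.
(* With d the degree of [g], all d roots over [x] equal x_k, so by Vieta the coefficient of index d
   - 1 is - d x_k times the leading one; d is invertible in characteristic zero. *)
pose a := (size g).-1%:R *: lead_coef g.
have sg1 : (1 < size g)%N.
  have : (size g != 0)%N.
    by apply: contraNneq gx1 => /eqP; rewrite size_poly_eq0 => /eqP ->; rewrite lead_coef0 /rveval meval0.
  rewrite -lt0n leq_eqVlt => /predU1P[/esym/eqP/size_poly1P[c c0 gc]|//].
  have := YE _ _ Yg Cx1; rewrite gc specC hornerC => E.
  by move: gx1; rewrite gc lead_coefC E eqxx.
have aE x : rveval a (x *m M) = (size g).-1%:R * rveval (lead_coef g) (x *m M).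
  by rewrite /rveval mevalZ.
have d0 : (size g).-1%:R != 0 :> K.
  by rewrite pnatr_eq0 -lt0n -ltnS prednK// ltnW.
exists a, (- g`_(size g).-2); split.
  by exists x1; rewrite // aE mulf_neq0.
move=> x Cx; rewrite aE mulf_eq0 (negPf d0) /= => gx.
have sgx : size (spec (x *m M) g) = size g by rewrite size_map_poly_id0.
have lgx : lead_coef (spec (x *m M) g) = rveval (lead_coef g) (x *m M).
  by rewrite lead_coefE sgx coef_spec -lead_coefE.
have [rs rsE] := closed_field_poly_normal (spec (x *m M) g).
have rs_x t : t \in rs -> t = x ord0 k.
  move=> trs; apply: fibre => //; rewrite rsE rootZ ?lgx//.
  by rewrite root_prod_XsubC.
have srs : size rs = (size g).-1.
  by rewrite -sgx rsE size_scale ?lgx// size_prod_XsubC.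
have : rveval g`_(size g).-2 (x *m M) =
    - (rveval (lead_coef g) (x *m M) * ((size g).-1%:R * x ord0 k)).
  rewrite -coef_spec rsE coefZ lgx -srs coefPn_prod_XsubC; last first.
    by rewrite srs -lt0n -ltnS prednK// ltnW.
  rewrite mulrN; congr (- (_ * _)).
  rewrite (eq_big_seq (fun=> x ord0 k)) => [|t /rs_x//].
  by rewrite big_const_seq count_predT iter_addr_0 mulr_natl.
rewrite /rveval mevalN => ->; rewrite opprK.
by field; apply/andP.
Qed.

End GenericInverse.

(** * Strong continuity of the inverse of the linear map on the cone *)

Section StrongTopology.
Variable K : numClosedFieldType.
Notation zclosed := (zariski_closed (idfun : {rmorphism K -> K})).

Lemma continuous_sum (T : topologicalType) I (r : seq I) (F : I -> T -> K) :
  (forall i, continuous (F i)) -> continuous (fun x => \sum_(i <- r) F i x).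
Proof.
move=> Fc; elim: r => [|i r IH] x.
  rewrite (_ : (fun x => _) = cst 0); first exact: cst_continuous.
  by apply/funext => y; rewrite big_nil.
rewrite (_ : (fun x => _) = F i \+ (fun x => \sum_(i <- r) F i x)).
  by apply: continuousD; [exact: Fc|exact: IH].
by apply/funext => y; rewrite big_cons.
Qed.

Lemma continuous_exp (T : topologicalType) (f : T -> K) k :
  continuous f -> continuous (fun x => f x ^+ k).
Proof.
move=> fc; elim: k => [|k IH] x.
  by rewrite (_ : (fun x => _) = cst 1)//; exact: cst_continuous.
rewrite (_ : (fun x => _) = f \* (fun x => f x ^+ k)).
  by apply: continuousM; [exact: fc|exact: IH].
by apply/funext => y; rewrite exprS.
Qed.

Lemma rveval_continuous n (p : {mpoly K[n]}) :
  continuous (rveval p : 'rV[K]_n -> K).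
Proof.
pose P (p : {mpoly K[n]}) := continuous (rveval p : 'rV[K]_n -> K).
have PC c : P (mpolyC n c).
  move=> y; rewrite (_ : rveval _ = cst c); first exact: cst_continuous.
  by apply/funext => x; rewrite /rveval mevalC.
have PD q r : P q -> P r -> P (q + r).
  move=> Pq Pr y; rewrite (_ : rveval _ = rveval q \+ rveval r).
    by apply: continuousD; [exact: Pq|exact: Pr].
  by apply/funext => x; rewrite /rveval mevalD.
have PM q r : P q -> P r -> P (q * r).
  move=> Pq Pr y; rewrite (_ : rveval _ = rveval q \* rveval r).
    by apply: continuousM; [exact: Pq|exact: Pr].
  by apply/funext => x; rewrite /rveval mevalM.
have PX i : P (mpolyX K (mnm1 i)).
  move=> y; rewrite (_ : rveval _ = (fun x : 'rV_n => x ord0 i)).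
    exact: coord_continuous.
  by apply/funext => x; rewrite /rveval mevalXU.
rewrite [p]mpolyE; apply: (big_ind P) => [||m _]; [|exact: PD|].
  by rewrite -mpolyC0; exact: PC.
rewrite -mul_mpolyC; apply: (PM); first exact: PC.
rewrite mpolyXE_id; apply: (big_ind P) => [||i _]; [rewrite -(mpolyC1 n K); exact: PC|exact: PM|].
elim: (m i) => [|k IH]; first by rewrite expr0 -(mpolyC1 n K); exact: PC.
by rewrite exprS; exact: PM.
Qed.

Lemma zclosed_strongly_closed n (X : set 'rV[K]_n) : zclosed X -> closed X.
Proof.
move=> /zclosedP Xc.
have -> : X = \bigcap_(p in [set p | forall x, X x -> rveval p x = 0])
    (rveval p @^-1` [set 0]).
  by apply/seteqP; split=> [x Xx p /(_ _ Xx)//|x H]; apply: Xc.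
apply: closed_bigI => p _; apply: preimage_closed.
  by move=> x _; exact: rveval_continuous.
exact/accessible_closed_set1/hausdorff_accessible/norm_hausdorff.
Qed.

(** If |t| > 1, the lower terms of f(t) = 0 are bounded by |f_i| times the power of |t| one below
    the degree; division by that power bounds |t|. *)
Lemma monic_root_bound (f : {poly K}) t : f \is monic -> root f t ->
  `|t| <= 1 + \sum_(i < (size f).-1) `|f`_i|.
Proof.
move=> mf /rootP ft; have [t1|t1] := real_leP (normr_real t) (@real1 K).
  by rewrite (le_trans t1)// lerDl sumr_ge0.
rewrite (@le_trans _ _ (\sum_(i < (size f).-1) `|f`_i|))//; last by rewrite lerDr.
have t0 : 0 < `|t| by exact: lt_trans t1.
have sf : (0 < size f)%N by rewrite size_poly_gt0 monic_neq0.
case sE: (size f).-1 => [|d].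
  by have := root_size_gt1 (monic_neq0 mf) (introT rootP ft); rewrite -(prednK sf) sE.
rewrite -(ler_pM2r (exprn_gt0 d t0)) -exprS -normrX.
have -> : t ^+ d.+1 = - \sum_(i < d.+1) f`_i * t ^+ i.
  apply/eqP; rewrite -addr_eq0 addrC; apply/eqP; rewrite -[RHS]ft horner_coef -(prednK sf) sE [RHS]big_ord_recr /=.
  by rewrite -[X in f`_X]sE -lead_coefE (eqP mf) mul1r.
rewrite normrN (le_trans (ler_norm_sum _ _ _))// big_distrl /=.
apply: ler_sum => i _; rewrite normrM normrX ler_wpM2l//.
by rewrite ler_weXn2l// ?ltW// -ltnS.
Qed.

Variables (N : nat) (X : set 'rV[K]_N).
Hypotheses (Xc : zclosed X) (coneX : forall a x, X x -> X (a *: x)).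
Variables (n : nat) (M : 'M[K]_(N, n)).
Hypothesis Xinj : forall x x', X x -> X x' -> x *m M = x' *m M -> x = x'.

Let M0 x : X x -> x *m M = 0 -> x = 0.
Proof.
move=> Xx xM; apply: Xinj => //; last by rewrite xM mul0mx.
by rewrite -(scale0r x); exact: coneX.
Qed.

(* Over y0 = x0 *m M the coordinate x_k has the single value t0 = x0_k, so the
   relations between x_k and x *m M specialise at y0 to multiples of a power of
   T - t0; one that specialises to (T - t0)^s bounds |x_k - t0|^s near y0. *)
Lemma inverse_continuous x0 k (e : K) : X x0 -> 0 < e ->
  \forall y \near x0 *m M, forall x, X x -> x *m M = y -> `|x ord0 k - x0 ord0 k| < e.
Proof.
move=> Xx0 e0; pose t0 := x0 ord0 k; pose y0 := x0 *m M.
pose Y := [set x *m snocmx M (delta_mx k ord0) | x in X].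
have [f [Xf mf]] := snoc_coord_monic Xc coneX M0 k.
have [g [Xg g0 gmin]] := vanishing_generator y0 Xf mf.
have Yc : zclosed Y by exact: (snoc_coord_closed Xc coneX M0).
have groot t : root (spec y0 g) t -> t = t0.
  move=> gt; suff /(snoc_coord_image M X k)[x [Xx E <-]] : Y (snoc y0 t).
    by rewrite (Xinj Xx Xx0 E).
  apply: vanishing_closed => // h /gmin/dvdpP[u ->].
  by rewrite hornerM (rootP gt) mulr0.
have [rs rsE] := closed_field_poly_normal (spec y0 g).
have [c c0 gE] : exists2 c, c != 0 & spec y0 g = c *: ('X - t0%:P) ^+ size rs.
  exists (lead_coef (spec y0 g)); first by rewrite lead_coef_eq0.
  rewrite {1}rsE; congr (_ *: _); rewrite (eq_big_seq (fun=> 'X - t0%:P)).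
    by rewrite big_const_seq count_predT iter_mulr_1.
  move=> t trs; rewrite (groot t)// rsE rootZ ?lead_coef_eq0//.
  by rewrite root_prod_XsubC.
(* The continuous function [b] bounds x_k over y through the monic relation [f]. Hence [d], which is
   continuous and zero at [y0], bounds the difference of g at [y0] and at y, both taken at x_k. *)
pose b (y : 'rV[K]_n) := 1 + \sum_(i < (size f).-1) `|rveval f`_i y|.
pose d (y : 'rV[K]_n) := \sum_(i < size g) `|rveval g`_i y0 - rveval g`_i y| * b y ^+ i.
have bP x : X x -> `|x ord0 k| <= b (x *m M).
  move=> Xx; have sf : size (spec (x *m M) f) = size f.
    by rewrite size_map_poly_id0// (eqP mf) meval1 oner_neq0.
  have := @monic_root_bound (spec (x *m M) f) (x ord0 k).
  rewrite sf; under eq_bigr do rewrite coef_spec; apply; first exact: monic_map.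
  by apply/rootP; apply: Xf; apply/(snoc_coord_image M X k); exists x.
have dP x : X x -> `|c| * `|x ord0 k - t0| ^+ size rs <= d (x *m M).
  move=> Xx.
  have gx : (spec (x *m M) g).[x ord0 k] = 0.
    by apply: Xg; apply/(snoc_coord_image M X k); exists x.
  rewrite -normrX -normrM.
  have -> : c * (x ord0 k - t0) ^+ size rs =
      (spec y0 g).[x ord0 k] - (spec (x *m M) g).[x ord0 k].
    by rewrite gx subr0 gE hornerZ horner_exp hornerXsubC.
  rewrite !(@horner_coef_wide _ (size g)) ?size_poly// -sumrB.
  rewrite (le_trans (ler_norm_sum _ _ _))//; apply: ler_sum => i _.
  rewrite -mulrBl normrM !coef_spec ler_wpM2l// normrX.
  by rewrite lerXn2r ?nnegrE ?bP// (le_trans _ (bP _ Xx)).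
have dc : continuous d.
  have bc : continuous b.
    move=> y; apply: continuousD; first exact: cst_continuous.
    apply: continuous_sum => i z; apply: continuous_comp; first exact: rveval_continuous.
    exact: norm_continuous.
  apply: continuous_sum => i y.
  pose h z := `|rveval g`_i y0 - rveval g`_i z|.
  apply: (@continuousM _ _ h (fun z => b z ^+ i)); last exact: continuous_exp.
  apply: (@continuous_comp _ _ _ (fun z => rveval g`_i y0 - rveval g`_i z) Num.norm).
    by apply: continuousB; [exact: cst_continuous|exact: rveval_continuous].
  exact: norm_continuous.
have d0 : d y0 = 0.
  by rewrite /d big1// => i _; rewrite subrr normr0 mul0r.
have ces : 0 < `|c| * e ^+ size rs by rewrite mulr_gt0 ?normr_gt0 ?exprn_gt0.
have : \forall y \near y0, `|d y0 - d y| < `|c| * e ^+ size rs.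
  exact: cvgr_dist_lt (dc y0) _ ces.
apply: filterS => y; rewrite d0 sub0r normrN => dy x Xx xy.
rewrite real_ltNge ?normr_real ?gtr0_real//; apply/negP => ex.
have h1 := dP x Xx; rewrite xy in h1.
have h2 : `|c| * e ^+ size rs <= `|c| * `|x ord0 k - t0| ^+ size rs.
  by rewrite ler_wpM2l// lerXn2r// nnegrE ?normr_ge0// ltW.
have d_ge0 : 0 <= d y by apply: le_trans h1; rewrite mulr_ge0 ?exprn_ge0.
rewrite ger0_norm// in dy.
by have := le_lt_trans (le_trans h2 h1) dy; rewrite ltxx.
Qed.

End StrongTopology.

(** * Hilbert's basis theorem *)

Section Noetherian.

Definition in_ideal (R : comNzRingType) (f : nat -> R) k x :=
  exists c : nat -> R, x = \sum_(i < k) c i * f i.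

(** The ascending chain condition, stated for the ideals generated by the initial segments of a
    sequence. *)
Definition noetherian (R : comNzRingType) :=
  forall f : nat -> R, exists k, in_ideal f k (f k).

Lemma in_ideal_le (R : comNzRingType) (f : nat -> R) k k' x :
  (k <= k')%N -> in_ideal f k x -> in_ideal f k' x.
Proof.
move=> kk' [c ->]; exists (fun i => if (i < k)%N then c i else 0).
rewrite (big_ord_widen k' (fun i => c i * f i) kk') big_mkcond /=.
by apply: eq_bigr => i _; case: ifP => // _; rewrite mul0r.
Qed.

Lemma in_idealD (R : comNzRingType) (f : nat -> R) k x y :
  in_ideal f k x -> in_ideal f k y -> in_ideal f k (x + y).
Proof.
move=> [c ->] [d ->]; exists (fun i => c i + d i).
by rewrite -big_split; apply: eq_bigr => i _; rewrite mulrDl.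
Qed.

Lemma in_idealM (R : comNzRingType) (f : nat -> R) k a x :
  in_ideal f k x -> in_ideal f k (a * x).
Proof.
move=> [c ->]; exists (fun i => a * c i).
by rewrite big_distrr; apply: eq_bigr => i _; rewrite /= mulrA.
Qed.

Lemma in_ideal_trans (R : comNzRingType) (f g : nat -> R) k k' x :
  (forall i, (i < k)%N -> in_ideal f k' (g i)) -> in_ideal g k x ->
  in_ideal f k' x.
Proof.
move=> fg [c ->]; elim: k fg => [|k IH] fg.
  by rewrite big_ord0; exists (fun=> 0); rewrite big1// => i _; rewrite mul0r.
rewrite big_ord_recr /=; apply: in_idealD; last exact/in_idealM/fg.
by apply: IH => i ik; apply: fg; exact: ltnW.
Qed.

Lemma in_ideal_gen (R : comNzRingType) (f : nat -> R) k i :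
  (i < k)%N -> in_ideal f k (f i).
Proof.
move=> ik; exists (fun j => (j == i)%:R); rewrite (bigD1 (Ordinal ik))//= eqxx mul1r.
by rewrite big1 ?addr0// => j /negPf; rewrite -val_eqE /= => ->; rewrite mul0r.
Qed.

Lemma in_ideal_bound (R : comNzRingType) (f g : nat -> R) k :
  (forall i, (i < k)%N -> exists K, in_ideal f K (g i)) ->
  exists K, forall i, (i < k)%N -> in_ideal f K (g i).
Proof.
elim: k => [|k IH] fg; first by exists 0%N.
have [|K fK] := IH; first by move=> i ik; apply: fg; exact: ltnW.
have [K' gk] := fg k (ltnSn k); exists (maxn K K') => i; rewrite ltnS leq_eqVlt.
move=> /predU1P[->|/fK gi]; first exact: in_ideal_le (leq_maxr _ _) gk.
exact: in_ideal_le (leq_maxl _ _) gi.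
Qed.

Lemma eq_in_ideal (R : comNzRingType) (f g : nat -> R) k x :
  (forall i, (i < k)%N -> f i = g i) -> in_ideal f k x -> in_ideal g k x.
Proof. by move=> fg [c ->]; exists c; apply: eq_bigr => i _; rewrite fg. Qed.

(** Recursion on the list of all earlier terms, for sequences in which each choice depends on the
    previous ones. *)
Lemma recursive_seq (T : Type) (G : seq T -> T) :
  exists g : nat -> T, forall k, g k = G (mkseq g k).
Proof.
pose gs := fix gs k := if k is k'.+1 then rcons (gs k') (G (gs k')) else [::].
exists (fun k => G (gs k)) => k; congr G.
by elim: k => //= k IH; rewrite {1}IH mkseqS.
Qed.

Lemma field_noetherian (F : fieldType) : noetherian F.
Proof.
move=> f; have [f0|f0] := eqVneq (f 0%N) 0.
  by exists 0%N, (fun=> 0); rewrite big_ord0.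
by exists 1%N, (fun=> f 1%N / f 0%N); rewrite big_ord1 divfK.
Qed.

Lemma noetherian_surj (R S : comNzRingType) (phi : {rmorphism R -> S}) :
  (forall y, exists x, phi x = y) -> noetherian R -> noetherian S.
Proof.
move=> /choice[psi psiK] noeR f; have [k [c fk]] := noeR (psi \o f).
exists k, (phi \o c); rewrite -[LHS]psiK [psi _]fk rmorph_sum.
by apply: eq_bigr => i _; rewrite rmorphM /= psiK.
Qed.

(** Hilbert's argument: in the ideal [I] of a bad sequence, each [g k] is chosen of minimal size
    outside the ideal of the earlier ones. Once its leading coefficient is a combination of the
    earlier ones, subtracting shifted multiples of these gives a smaller such element. *)
Lemma poly_noetherian (R : comNzRingType) : noetherian R -> noetherian {poly R}.
Proof.
move=> noeR f; apply: contrapT => /forallNP nf.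
pose I x := exists k, in_ideal f k x.
have II k x g : (forall i, (i < k)%N -> I (g i)) -> in_ideal g k x -> I x.
  move=> /in_ideal_bound[K fK] gx.
  by exists K; exact: in_ideal_trans gx.
have /choice[G GP] : forall s : seq {poly R}, exists h,
    (forall i, (i < size s)%N -> I s`_i) ->
    [/\ I h, ~ in_ideal (nth 0 s) (size s) h &
      forall h', I h' -> ~ in_ideal (nth 0 s) (size s) h' -> (size h <= size h')%N].
  move=> s; have [Is|nI] := pselect (forall i, (i < size s)%N -> I s`_i); last by exists 0.
  pose P n := `[< exists h, [/\ I h, ~ in_ideal (nth 0 s) (size s) h & size h = n] >].
  have exP : exists n, P n.
    (* The terms of [s] lie in the ideal of the [f i] with i < K, so that [f K] is in [I] but not in
       the ideal of [s]. *)
    have [K fK] := in_ideal_bound Is.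
    exists (size (f K)); apply/asboolP; exists (f K); split=> //.
      by exists K.+1; exact: in_ideal_gen.
    by move=> /(in_ideal_trans fK); exact: nf.
  case: (ex_minnP exP) => n /asboolP[h [Ih nh <-]] hmin.
  by exists h => _; split=> // h' Ih' nh'; apply: hmin; apply/asboolP; exists h'.
have [g gE] := recursive_seq G.
have mkE k i : (i < k)%N -> (mkseq g k)`_i = g i by move=> ik; rewrite nth_mkseq.
have Ig k : I (g k).
  have [n] := ubnP k; elim: n k => // n IH k; rewrite ltnS => kn.
  rewrite gE; have [] := GP (mkseq g k); rewrite ?size_mkseq// => i ik.
  by rewrite mkE//; apply: IH; exact: leq_trans kn.
have gP k : ~ in_ideal g k (g k) /\
    forall h, I h -> ~ in_ideal g k h -> (size (g k) <= size h)%N.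
  have := GP (mkseq g k); rewrite -gE size_mkseq => -[i ik|_ gk gmin].
    by rewrite mkE.
  split=> [|h Ih nh]; first by move=> gg; apply: gk; apply: eq_in_ideal gg => i ik; rewrite mkE.
  by apply: gmin => // hh; apply: nh; apply: eq_in_ideal hh => i ik; rewrite mkE.
have g_size i k : (i <= k)%N -> (size (g i) <= size (g k))%N.
  by move=> ik; apply: (gP i).2 => // gk; apply: (gP k).1; exact: in_ideal_le gk.
have g0 k : (0 < size (g k))%N.
  rewrite size_poly_gt0; apply/eqP => gk; apply: (gP k).1; rewrite gk.
  by exists (fun=> 0); rewrite big1// => i _; rewrite mul0r.
have [k [c ck]] := noeR (fun k => lead_coef (g k)).
(* The shift aligns the leading term of [g i] with that of [g k]; sizes increase along [g], so the
   subtraction is not truncated. *)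
pose c' i := (c i)%:P * 'X^(size (g k) - size (g i)).
pose s := \sum_(i < k) c' i * g i.
have sk : in_ideal g k s by exists c'.
have sh : (size (g k - s)%R < size (g k))%N.
  rewrite -[X in (_ < X)%N](prednK (g0 k)) ltnS; apply/leq_sizeP => j.
  rewrite leq_eqVlt coefB coef_sum => /predU1P[<-|].
    rewrite -lead_coefE ck; apply/eqP; rewrite subr_eq0; apply/eqP/eq_bigr => i _.
    rewrite -mulrA coefCM coefXnM ltnNge; have := g_size _ _ (ltnW (ltn_ord i)).
    move=> ik; have -> : (size (g k) - size (g i) <= (size (g k)).-1)%N.
      by rewrite leq_subLR -[X in (X <= _)%N](prednK (g0 k)) -addn1 addnC leq_add2r.
    rewrite lead_coefE; congr (_ * _`_ _).
    rewrite -subn1 -[in RHS]subn1 subnBA// addnC addnBA// addnC -addnBA; last exact: g0.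
    by rewrite addKn.
  rewrite prednK// => kj; rewrite nth_default// sub0r big1 ?oppr0// => i _.
  rewrite -mulrA coefCM coefXnM; case: ltnP => [_|_]; first by rewrite mulr0.
  rewrite nth_default ?mulr0// leq_subRL.
    by rewrite subnK// g_size// ltnW.
  by rewrite (leq_trans (leq_subr _ _)).
have : ~ in_ideal g k (g k - s).
  by move=> gs; apply: (gP k).1; rewrite -(subrK s (g k)); exact: in_idealD.
move=> /((gP k).2 _ _); rewrite leqNgt sh => /(_ _)/negP; apply=> //.
apply: (II k.+1 _ g) => //; apply: in_idealD; first exact: in_ideal_gen.
by rewrite -mulN1r; apply: in_idealM; exact: in_ideal_le sk.
Qed.

(** Only a surjection from polynomials in one variable over the ring in n variables is needed, not
    an isomorphism. *)
Lemma mpoly_noetherian (F : fieldType) n : noetherian {mpoly F[n]}.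
Proof.
elim: n => [|n IH].
  apply: (@noetherian_surj F {mpoly F[0]} (@mpolyC 0 F)); last exact: field_noetherian.
  by move=> p; exists (mcoeff (@mnm0 0) p); exact: (esym (mpoly0C p)).
pose X : {mpoly F[n.+1]} := mpolyX F (mnm1 ord_max).
have cX : commr_rmorph (@mwiden n F) X by move=> p; exact: mulrC.
apply: (@noetherian_surj _ _ (horner_morph cX)); last exact: poly_noetherian.
pose P q := exists u, horner_morph cX u = q.
have PC (c : F) : P (mpolyC n.+1 c).
  by exists (mpolyC n c)%:P; rewrite horner_morphC /= mwidenC.
have PD q r : P q -> P r -> P (q + r).
  by move=> [u <-] [v <-]; exists (u + v); rewrite rmorphD.
have PM q r : P q -> P r -> P (q * r).
  by move=> [u <-] [v <-]; exists (u * v); rewrite rmorphM.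
have P1 : P 1 by exists 1; rewrite rmorph1.
move=> p; rewrite [p]mpolyE; apply: (big_ind P) => [||m _].
- by exists 0; rewrite rmorph0.
- exact: PD.
rewrite -mul_mpolyC; apply: (PM) => //; rewrite mpolyXE_id.
apply: (big_ind P) => // i _.
elim: (m i) => [|k IHk]; first by rewrite expr0.
rewrite exprS; apply: (PM) => //; case: (unliftP ord_max i) => [j|] ->.
  exists (mpolyX F (mnm1 j))%:P.
  rewrite horner_morphC /= mwidenX mnmwiden1; congr (mpolyX _ (mnm1 _)).
  by apply: val_inj; rewrite /= /bump leqNgt ltn_ord.
by exists 'X; rewrite horner_morphX.
Qed.

(** A closed set may be given by infinitely many equations, while constructible sets are finite
    combinations. If no finite list sufficed, there would be a sequence of equations each failing at
    a common zero of the earlier ones. *)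
Lemma zclosed_constructible (K : numClosedFieldType) n (X : set 'rV[K]_n) :
  zariski_closed (idfun : {rmorphism K -> K}) X ->
  constructible (idfun : {rmorphism K -> K}) X.
Proof.
move=> /zclosedP Xc.
pose V : set {mpoly K[n]} := [set p | forall x, X x -> rveval p x = 0].
have [s [sV sX]] : exists s : seq {mpoly K[n]}, (forall p, p \in s -> V p) /\
    forall x, (forall p, p \in s -> rveval p x = 0) -> X x.
  apply: contrapT => ns.
  have /choice[G GP] : forall s : seq {mpoly K[n]}, exists p,
      (forall q, q \in s -> V q) -> V p /\ exists x,
        (forall q, q \in s -> rveval q x = 0) /\ rveval p x != 0.
    move=> s; have [sV|nV] := pselect (forall q, q \in s -> V q); last by exists 0.
    apply: contrapT => np; apply: ns; exists s; split=> // x xs.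
    apply: Xc => p pV; apply/eqP; apply: contraT => px; exfalso; apply: np.
    by exists p => _; split=> //; exists x.
  have [g gE] := recursive_seq G.
  have gV k : V (g k).
    have [m] := ubnP k; elim: m k => // m IH k; rewrite ltnS => km.
    rewrite gE; apply: (proj1 (GP _ _)) => q /(nthP 0)[j]; rewrite size_mkseq => ik <-.
    by rewrite nth_mkseq//; apply: IH; exact: leq_trans km.
  have [k [c gk]] := mpoly_noetherian g.
  have [_ [x [xs]]] : V (g k) /\ exists x,
      (forall q, q \in mkseq g k -> rveval q x = 0) /\ rveval (g k) x != 0.
    by rewrite [g k]gE; apply: GP => q /(nthP 0)[j]; rewrite size_mkseq => ik <-; rewrite nth_mkseq.
  rewrite gk /rveval raddf_sum /= big1 ?eqxx// => i _.
  rewrite mevalM -/(rveval (g i) x) xs ?mulr0//.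
  by apply: (introT (nthP 0)); exists (i : nat); rewrite ?size_mkseq ?nth_mkseq.
have -> : X = [set x | forall p, p \in s -> rveval p x = 0].
  by apply/seteqP; split=> [x Xx p /sV|x /sX]//; apply.
elim: s {sV sX} => [|p s IH].
  rewrite (_ : [set x | _] = [set x | peval (idfun : {rmorphism K -> K}) 0 x = 0]).
    exact: constructible_zeros.
  by apply/seteqP; split=> x // _; rewrite /= peval_idfun /rveval meval0.
rewrite (_ : [set x | _] = ~` (~` [set x | peval (idfun : {rmorphism K -> K}) p x = 0] `|`
    ~` [set x | forall p, p \in s -> rveval p x = 0])).
  apply: constructibleC; apply: constructibleU; apply: constructibleC => //.
  exact: constructible_zeros.
rewrite -setCI setCK; apply/seteqP; split=> x /=.
  move=> H; split; first by rewrite peval_idfun; apply: H; exact: mem_head.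
  by move=> q qs; apply: H; rewrite inE qs orbT.
by rewrite peval_idfun => -[px xs] q; rewrite inE => /predU1P[->//|/xs].
Qed.

End Noetherian.

(** * The map induced on projective sets *)

Section ProjectiveInverse.
Variable K : numClosedFieldType.
Variables (N n : nat) (X : set 'rV[K]_N) (M : 'M[K]_(N, n)).
Variable tau : 'rV[K]_n -> 'rV[K]_N.
Hypotheses (Xc : zariski_closed (idfun : {rmorphism K -> K}) X)
  (coneX : forall a x, X x -> X (a *: x))
  (Xinj : forall x x', X x -> X x' -> x *m M = x' *m M -> x = x')
  (tauK : forall x, X x -> tau (x *m M) = x).
Local Notation Y := [set x *m M | x in X].

Lemma tau_continuous x (G : set 'rV[K]_N) : Y x -> nbhs (tau x) G ->
  \forall y \near x, Y y -> G (tau y).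
Proof.
move=> [x0 Xx0 <-]; rewrite tauK// => /nbhs_ballP[e e0 eG].
have /filter_forall := fun k => inverse_continuous Xc coneX Xinj k Xx0 e0.
apply: filterS => y yP [x1 Xx1 xy]; apply: eG; split=> // i k.
rewrite -xy tauK// ord1 /ball /= distrC; exact: yP.
Qed.

Lemma tau_scale a y : Y y -> tau (a *: y) = a *: tau y.
Proof.
by move=> [x Xx <-]; rewrite scalemxAl !tauK//; exact: coneX.
Qed.

Lemma coneY a y : Y y -> Y (a *: y).
Proof. by move=> [x Xx <-]; exists (a *: x); [exact: coneX|rewrite scalemxAl]. Qed.

Lemma Y_tau y : Y y -> X (tau y) /\ tau y *m M = y.
Proof. by move=> [x Xx <-]; rewrite tauK. Qed.

Lemma tau_neq0 y : Y y -> y != 0 -> tau y != 0.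
Proof.
move=> /Y_tau[_ ty]; apply: contra_neq => t0.
by rewrite -ty t0 mul0mx.
Qed.

Lemma proj_ptP k (x y : punctured K k) :
  proj_pt x = proj_pt y <-> exists2 a : K, a != 0 & \val y = a *: \val x.
Proof.
split=> [/eqmodP/asboolP//|xy].
by apply/eqmodP/asboolP.
Qed.

Definition puncture k (x : 'rV[K]_k) (x0 : x != 0) : punctured K k :=
  SigSub (@mem_set _ [set x : 'rV[K]_k | x != 0] x x0).

(** The class of y goes to the class of [tau y], which is well defined because [tau] commutes with
    scaling on the cone and has no other zero than 0. *)
Lemma continuous_projective_inverse :
  induces_continuous_projective_encoding Y X tau.
Proof.
have fP_ex (p : set_type (projectivization Y)) :
    exists q : set_type (projectivization X), exists (x : punctured K n) (y : punctured K N),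
      [/\ Y (\val x), \val p = proj_pt x, \val y = tau (\val x) & \val q = proj_pt y].
  have [x Yx px] := set_mem (valP p).
  have x0 : \val x != 0 := set_mem (valP x).
  pose y := puncture (tau_neq0 Yx x0).
  have Xy : projectivization X (proj_pt y).
    by exists y => //; case: (Y_tau Yx).
  by exists (SigSub (mem_set Xy)), x, y.
have [fP fPP] := choice fP_ex.
have fP_ind : induces_projective tau fP.
  move=> p x Yx px; have [x' [y' [Yx' px' yx' fpy']]] := fPP p.
  exists (puncture (tau_neq0 Yx (set_mem (valP x)))) => //.
  rewrite fpy'; apply/proj_ptP.
  have [a a0 xE] : exists2 a : K, a != 0 & \val x = a *: \val x'.
    by apply/proj_ptP; rewrite -px' px.
  by exists a => //; rewrite /= yx' xE tau_scale.
exists fP; split=> //.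
  apply/seteqP; split=> // q _; have [y Xy qy] := set_mem (valP q).
  have yM0 : \val y *m M != 0.
    apply/eqP => yM; have := set_mem (valP y); rewrite /= => /eqP; apply.
    apply: Xinj => //; last by rewrite yM mul0mx.
    by rewrite -(scale0r (\val y)); exact: coneX.
  pose x := puncture yM0.
  have Yx : projectivization Y (proj_pt x) by exists x => //; exists (\val y).
  exists (SigSub (mem_set Yx)) => //; apply: val_inj.
  have [|y' y'E ->] := fP_ind (SigSub (mem_set Yx)) x _ erefl; first by exists (\val y).
  rewrite -qy; congr proj_pt; apply: val_inj.
  by rewrite y'E /= tauK.
apply/continuousP => B [V Vo <-].
have [G Go GE] : open (@proj_pt K N @^-1` V) by exact: Vo.
have GP (y : punctured K N) : G (\val y) <-> V (proj_pt y).
  by rewrite -[V _]/((@proj_pt K N @^-1` V) y) -GE.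
(* This condition is empty off [Y], so it can be imposed on whole neighbourhoods in the ambient
   space; it is also invariant under non-zero scaling. *)
pose P := [set x | Y x -> x != 0 -> G (tau x)].
have Gscale (a : K) (y : 'rV[K]_N) : a != 0 -> y != 0 -> G y -> G (a *: y).
  move=> a0 y0; have ay0 : a *: y != 0 by rewrite scaler_eq0 negb_or a0.
  rewrite -[y]/(\val (puncture y0)) -[_ *: _]/(\val (puncture ay0)) => /GP Vy.
  apply/GP; suff <- : proj_pt (puncture y0) = proj_pt (puncture ay0) by [].
  by apply/proj_ptP; exists a.
have Pscale (a : K) (x : 'rV[K]_n) : a != 0 -> P x -> P (a *: x).
  move=> a0 Px Yax; rewrite scaler_eq0 negb_or => /andP[_ x0].
  have Yx : Y x by rewrite -[x]scale1r -(mulVf a0) -scalerA; exact: coneY.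
  rewrite tau_scale//; apply: Gscale => //; first exact: tau_neq0.
  exact: Px.
have nPscale (a : K) (x : 'rV[K]_n) : a != 0 -> nbhs x P -> nbhs (a *: x) P.
  move=> a0 xP.
  have : nbhs (a *: x) [set y | P (a^-1 *: y)].
    have := @scaler_continuous _ _ a^-1 (a *: x) P.
    by rewrite scalerA mulVf// scale1r; exact.
  apply: filterS => y /(Pscale a _ a0).
  by rewrite scalerA mulfV// scale1r.
(* The classes of the interior points of [P]; by invariance the choice of representative does not
   matter, so [U] is open in the quotient. *)
pose U : set (projective_space K n) := [set q | exists2 x, q = proj_pt x & nbhs (\val x) P].
have UE (x : punctured K n) : U (proj_pt x) <-> nbhs (\val x) P.
  split=> [[x' /esym/proj_ptP[a a0 ->] xP]|xP]; [exact: nPscale|by exists x].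
have UV (p : set_type (projectivization Y)) : U (\val p) <-> V (\val (fP p)).
  have [x Yx px] := set_mem (valP p).
  have [y yE ->] := fP_ind p x Yx (esym px).
  rewrite -px; split=> [/UE xP|/GP].
    apply/GP; rewrite yE; apply: (nbhs_singleton xP) => //.
    exact: set_mem (valP x).
  rewrite yE => Gx; apply/UE.
  have : nbhs (tau (\val x)) G by exact: open_nbhs_nbhs.
  by move=> /(tau_continuous Yx); apply: filterS => z zG Yz _; exact: zG.
exists U; last by apply/seteqP; split=> p /UV.
rewrite /open /= /quotient_open; exists P°; first exact: open_interior.
by apply/seteqP; split=> x /UE.
Qed.

End ProjectiveInverse.

(** * Embedded cones and object classes *)

Section EmbeddedCone.
Variable K : numClosedFieldType.
Notation zclosed := (zariski_closed (idfun : {rmorphism K -> K})).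
Variables (T : Type) (N n : nat) (e : T -> 'rV[K]_N) (O : set T).
Variables (sigma : T -> 'rV[K]_n) (M : 'M[K]_(N, n)).
Hypotheses (e_inj : forall F G, O F -> O G -> e F = e G -> F = G)
  (sigmaE : forall F, O F -> sigma F = e F *m M)
  (Xc : zclosed (e @` O))
  (coneX : forall a x, (e @` O) x -> (e @` O) (a *: x))
  (Xinj : forall x x', (e @` O) x -> (e @` O) x' -> x *m M = x' *m M -> x = x').
Local Notation X := (e @` O).

Lemma cone_kernel x : X x -> x *m M = 0 -> x = 0.
Proof.
move=> Xx xM; apply: Xinj => //; last by rewrite xM mul0mx.
by rewrite -(scale0r x); exact: coneX.
Qed.

Lemma sigma_inj F G : O F -> O G -> sigma F = sigma G -> F = G.
Proof.
move=> OF OG; rewrite !sigmaE// => /Xinj FG; apply: e_inj => //.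
by apply: FG; [exists F|exists G].
Qed.

Lemma sigma_image Z : Z `<=` O -> sigma @` Z = [set x *m M | x in e @` Z].
Proof.
move=> ZO; apply/seteqP; split=> [_ [F ZF <-]|_ [_ [F ZF <-] <-]].
  by exists (e F); [exists F|rewrite sigmaE//; exact: ZO].
by exists F => //; rewrite sigmaE//; exact: ZO.
Qed.

Lemma image_sub Z : Z `<=` O -> e @` Z `<=` X.
Proof. by move=> ZO _ [F ZF <-]; exists F => //; exact: ZO. Qed.

Lemma closed_in_image C Z : zclosed (e @` C) -> closed_in e C Z -> zclosed (e @` Z).
Proof.
move=> Cc [V Vc ->]; rewrite (_ : e @` _ = e @` C `&` V).
  exact: zclosedI.
apply/seteqP; split=> [_ [F [CF VF] <-]|_ [[F CF <-] VF]]; last by exists F.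
by split=> //; exists F.
Qed.

Lemma closed_sigma_image Z : Z `<=` O -> zclosed (e @` Z) -> zclosed (sigma @` Z).
Proof.
move=> ZO Zc; rewrite sigma_image//.
have [+ _] := cone_closed_finite Xc coneX cone_kernel.
by apply=> //; exact: image_sub.
Qed.

Lemma sigma_bij Z : Z `<=` O -> set_bij Z (sigma @` Z) sigma.
Proof.
move=> ZO; split=> [F ZF|F G|//]; first by exists F.
by rewrite !inE => /ZO OF /ZO OG; exact: sigma_inj.
Qed.

Lemma sigma_morphism Z : Z `<=` O -> variety_morphism e Z id (sigma @` Z) sigma.
Proof.
move=> ZO; split=> [F ZF|]; first by exists F.
exists (fun j => linform (col j M)) => F /ZO OF j.
by rewrite rveval_linform_col sigmaE.
Qed.

Lemma sigma_finite Z : Z `<=` O -> finite_morphism e Z id (sigma @` Z) sigma.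
Proof.
move=> ZO; split; first exact: sigma_morphism.
have [_ [I [g gP]]] := cone_closed_finite Xc coneX cone_kernel.
exists #|I|, (g \o enum_val) => p; have [h hP] := gP p.
exists (h \o enum_val) => F /ZO OF; rewrite hP; last by exists F.
rewrite -sigmaE// (reindex _ (onW_bij _ (enum_val_bij I))).
by apply: eq_big => // i; rewrite -sigmaE.
Qed.

Lemma irreducible_prime C p q : irreducible e C ->
  (forall F, C F -> rveval p (e F) * rveval q (e F) = 0) ->
  (forall F, C F -> rveval p (e F) = 0) \/ (forall F, C F -> rveval q (e F) = 0).
Proof.
move=> [_ irrC] pq.
have Zcl r : closed_in e C (C `&` e @^-1` [set x | rveval r x = 0]).
  by exists [set x | rveval r x = 0]; first exact: zclosed_zero.
have [|E|E] := irrC _ _ (Zcl p) (Zcl q).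
- apply/seteqP; split=> [F CF|F [[]|[]]//].
  by have /eqP := pq F CF; rewrite mulf_eq0 => /orP[] /eqP; [left|right].
- by left=> F; rewrite {1}E => -[].
- by right=> F; rewrite {1}E => -[].
Qed.

(** The vanishing ideal of an irreducible set is prime, so finitely many non-empty basic open
    subsets have a common point. *)
Lemma irreducible_prod C (I : finType) (p : I -> {mpoly K[N]}) : irreducible e C ->
  (forall i, exists2 F, C F & rveval (p i) (e F) != 0) ->
  exists2 F, C F & forall i, rveval (p i) (e F) != 0.
Proof.
move=> irrC pC.
have prodE F : rveval (\prod_i p i) (e F) = \prod_i rveval (p i) (e F).
  by rewrite /rveval rmorph_prod.
suff [F CF pF] : exists2 F, C F & rveval (\prod_i p i) (e F) != 0.
  by exists F => // i; move: pF; rewrite prodE prodf_seq_neq0 => /allP/(_ i); apply; rewrite mem_index_enum.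
apply: (big_ind (fun q => exists2 F, C F & rveval q (e F) != 0)) => //.
  have [[F CF] _] := irrC; exists F => //.
  by rewrite /rveval meval1 oner_neq0.
move=> q r [F CF qF] [G CG rG]; apply: contrapT => nqr.
have [H CH|qC|rC] := @irreducible_prime C q r irrC.
- apply/eqP; apply: contraT => qrH; exfalso; apply: nqr; exists H => //.
  by rewrite /rveval mevalM.
- by rewrite qC ?eqxx in qF.
- by rewrite rC ?eqxx in rG.
Qed.

(** The closure of an irreducible set is irreducible, so by maximality a component equals its
    closure in [O]. *)
Lemma component_closed C : irreducible_component e O C -> zclosed (e @` C).
Proof.
move=> [CO [[F0 CF0] irrC] maxC].
pose V : set 'rV[K]_N := [set x | forall p, (forall F, C F -> rveval p (e F) = 0) -> rveval p x = 0].
pose C' := O `&` e @^-1` V.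
have CC' : C `<=` C' by move=> F CF; split=> [|p]; [exact: CO|exact].
have VW W : zclosed W -> C `<=` e @^-1` W -> V `<=` W.
  move=> /zclosedP Wc CW x Vx; apply: Wc => p pW; apply: Vx => F CF.
  by apply: pW; exact: CW.
have C'C : C' = C.
  apply: maxC => //; last by move=> F [].
  split=> [|Z1 Z2 [V1 V1c Z1E] [V2 V2c Z2E] C'E]; first by exists F0; exact: CC'.
  have [|||E|E] := irrC (C `&` e @^-1` V1) (C `&` e @^-1` V2).
  - by exists V1.
  - by exists V2.
  - apply/seteqP; split=> [F CF|F [[]|[]]//].
    have : C' F by exact: CC'.
    by rewrite C'E Z1E Z2E => -[[_ VF]|[_ VF]]; [left|right].
  - left; rewrite Z1E; apply/seteqP; split=> [F [OF VF]|F []//]; split=> //.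
    by apply: (VW V1) => // G; rewrite E => -[].
  - right; rewrite Z2E; apply/seteqP; split=> [F [OF VF]|F []//]; split=> //.
    by apply: (VW V2) => // G; rewrite E => -[].
apply/zclosedP => x Hx; have [F OF Fx] : X x.
  move/zclosedP: (Xc); apply=> p pX; apply: Hx => _ [F CF <-]; apply: pX.
  by exists F => //; exact: CO.
exists F => //; rewrite -C'C; split=> // p pC; rewrite Fx; apply: Hx => _ [G CG <-].
exact: pC.
Qed.

Lemma sigma_irreducible C : C `<=` O -> irreducible e C -> irreducible id (sigma @` C).
Proof.
move=> CO [[F0 CF0] irrC]; split=> [|Z1 Z2 [V1 V1c Z1E] [V2 V2c Z2E] E].
  by exists (sigma F0), F0.
have sV V : zclosed V -> closed_in e C (C `&` sigma @^-1` V).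
  move=> Vc; exists [set x | V (x *m M)]; first exact: zclosed_mulmx_preimage.
  by apply/seteqP; split=> F [CF]; rewrite /= (sigmaE (CO _ CF)).
have [|CE|CE] := irrC _ _ (sV _ V1c) (sV _ V2c).
- apply/seteqP; split=> [F CF|F [[]|[]]//].
  have : (sigma @` C) (sigma F) by exists F.
  by rewrite E Z1E Z2E => -[[_ VF]|[_ VF]]; [left|right].
- left; rewrite Z1E; apply/seteqP; split=> [_ [F CF <-]|y []//].
  by split; [exists F|move: CF; rewrite CE => -[]].
- right; rewrite Z2E; apply/seteqP; split=> [_ [F CF <-]|y []//].
  by split; [exists F|move: CF; rewrite CE => -[]].
Qed.

(** Each coordinate x_k is a quotient b_k / a_k at the image of x. The open sets are those where no
    a_k vanishes; irreducibility makes them non-empty. *)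
Lemma sigma_birational C : C `<=` O -> irreducible e C -> zclosed (e @` C) ->
  birational_morphism e C id (sigma @` C) sigma.
Proof.
move=> CO irrC Cc; split; first exact: sigma_morphism.
have Cinj x x' : (e @` C) x -> (e @` C) x' -> x *m M = x' *m M -> x = x'.
  by move=> Cx Cx'; apply: Xinj; exact: (image_sub CO).
have C0 : e @` C !=set0 by have [[F CF] _] := irrC; exists (e F), F.
have /choice[a /choice[b abP]] := fun k =>
  generic_inverse Xc coneX cone_kernel k Cc (image_sub CO) C0 Cinj.
pose U := [set F | C F /\ forall k, rveval (a k) (sigma F) != 0].
pose V := [set y | (sigma @` C) y /\ forall k, rveval (a k) y != 0].
have /choice[g gP] : forall y, exists F : T, (sigma @` C) y -> C F /\ sigma F = y.
  move=> y; have [[F CF Fy]|ny] := pselect ((sigma @` C) y); first by exists F.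
  by have [[F CF] _] := irrC; exists F => /ny.
have gK F : C F -> g (sigma F) = F.
  move=> CF; have [CG sG] : C (g (sigma F)) /\ sigma (g (sigma F)) = sigma F.
    by apply: gP; exists F.
  by apply: sigma_inj => //; exact: CO.
have [ab abE] : {ab | forall y, rveval ab y = \prod_k rveval (a k) y}.
  by exists (\prod_k a k) => y; rewrite /rveval rmorph_prod.
have ab0 y : (forall k, rveval (a k) y != 0) <-> rveval ab y != 0.
  rewrite abE prodf_seq_neq0; split=> [ay|/allP ay k]; first by apply/allP => k _; rewrite ay.
  by have := ay k; rewrite mem_index_enum => /(_ isT).
have ab_zeros : zclosed [set y | rveval ab y = 0] by exact: zclosed_zero.
have U0 : U !=set0.
  have qP k := rveval_mulmx M (a k).
  have [|F CF aF] := @irreducible_prod C 'I_N (fun k => sval (qP k)) irrC.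
    move=> k; have [[_ [F CF <-] aF] _] := abP k; exists F => //.
    by case: (qP k) => q /= ->.
  exists F; split=> // k; rewrite (sigmaE (CO _ CF)).
  by have := aF k; case: (qP k) => q /= ->.
exists U, V, g; split.
- split=> //.
  exists (C `&` e @^-1` [set x | rveval ab (x *m M) = 0]).
    by exists [set x | rveval ab (x *m M) = 0]; first exact: (zclosed_mulmx_preimage M ab_zeros).
  apply/seteqP; split=> F.
    move=> [CF /ab0]; rewrite (sigmaE (CO _ CF)) => /eqP aF; split=> // -[].
    by move=> _ /aF.
  move=> [CF aF]; split=> //; apply/ab0/eqP => aF0; apply: aF; split=> //.
  by rewrite /= -(sigmaE (CO _ CF)).
- have [F [CF aF]] := U0.
  split; last by exists (sigma F); split=> //; exists F.
  exists (sigma @` C `&` [set y | rveval ab y = 0]).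
    by exists [set y | rveval ab y = 0].
  apply/seteqP; split=> y.
    by move=> [Cy /ab0/eqP ay]; split=> // -[_ /ay].
  by move=> [Cy ay]; split=> //; apply/ab0/eqP => ay0; apply: ay.
- split=> [F [CF aF]|j]; first by split=> //; exists F.
  move=> F _; exists (linform (col j M)), 1; split.
    by rewrite /rveval meval1 oner_neq0.
  move=> G [CG _] _; rewrite rveval_linform_col (sigmaE (CO _ CG)).
  by rewrite [rveval 1 _]meval1 divr1.
- split=> [_ [[F CF <-] aF]|k]; first by rewrite gK.
  move=> y [_ ay]; exists (b k), (a k); split; first exact: ay.
  move=> _ [[F CF <-] _] /= aF; rewrite gK// (sigmaE (CO _ CF)).
  apply: (abP k).2; first by exists F.
  by rewrite -sigmaE//; exact: CO.
- split=> [F [CF _]|_ [[F CF <-] _]]; first exact: gK.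
  by rewrite gK.
Qed.

Variable omega : 'rV[K]_n -> T.
Hypothesis omegaK : forall F, O F -> omega (sigma F) = F.

Lemma omega_encoding : encoding (idfun : {rmorphism K -> K}) (sigma @` O) O omega.
Proof.
split.
- by apply: zclosed_constructible; exact: closed_sigma_image.
- by move=> _ [F OF <-]; rewrite omegaK.
- by move=> F OF; exists (sigma F); rewrite ?omegaK//; exists F.
Qed.

(** The preimage of a closed [Z] under the inverse is its image under [sigma], which is closed. *)
Lemma omega_continuous : zariski_continuous id (sigma @` O) e O omega.
Proof.
split=> [_ [F OF <-]|Z OZ]; first by rewrite omegaK.
have ZO : Z `<=` O by case: OZ => V _ -> F [].
exists (sigma @` Z); first by apply: closed_sigma_image => //; exact: closed_in_image OZ.
apply/seteqP; split=> [_ [[F OF <-]]|_ [[F OF <-] [G ZG sG]]].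
  by rewrite /= omegaK// => ZF; split; exists F.
split; first by exists F.
by rewrite /= omegaK// -(sigma_inj (ZO _ ZG) OF sG).
Qed.

Lemma omega_projective :
  induces_continuous_projective_encoding (sigma @` O) X (e \o omega).
Proof.
rewrite sigma_image//; apply: continuous_projective_inverse => //.
by move=> _ [F OF <-]; rewrite /= -sigmaE// omegaK.
Qed.

End EmbeddedCone.

(** * The closure of an object class in coordinates *)

Section ObjectClass.
Variable R : realType.
Local Notation K := (R[i]).
Local Notation ratr_K := (ratr : {rmorphism rat -> K}).
Notation zclosed := (zariski_closed (idfun : {rmorphism K -> K})).

Lemma zariski_closure_zclosed n (X : set 'rV[K]_n) : zclosed (zariski_closure ratr_K X).
Proof.
apply/zclosedP => x Hx V [[P VE] XV]; rewrite VE => p Pp; apply: Hx => y yX.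
have : V y by apply: yX; split=> //; exists P.
by rewrite VE; exact.
Qed.

(** The homogeneous parts of a rational polynomial are rational, so those vanishing on the cone also
    vanish on its Q-closure. *)
Lemma zariski_closure_cone n (X : set 'rV[K]_n) :
  (forall a x, X x -> X (a *: x)) ->
  forall a x, zariski_closure ratr_K X x -> zariski_closure ratr_K X (a *: x).
Proof.
move=> coneX a x xX V [[P VE] XV]; rewrite VE => p Pp.
rewrite peval_scale big1// => d _; rewrite (zariski_closure_vanish _ xX) ?mulr0//.
move=> y Xy; apply: (cone_hpart coneX) => // z /XV.
by rewrite VE => /(_ _ Pp).
Qed.

Variables (L m t : nat) (gamma : 'M[R]_(m, t)).
Hypotheses (m_gt2L : (2 * L < m)%N) (gamma_generic : generic_points gamma).
Variables (O : set {mpoly K[t]}) (N : nat) (Q : 'M[rat]_(N, t)).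
Variables (d : nat) (b : 'I_d -> {mpoly rat[t]}).
Hypotheses (b_inj : injective (comb b : 'rV[K]_d -> _))
  (b_span : range (comb b : 'rV[K]_d -> _) = lin_span O).
Hypotheses (Q_inj : embeds_span Q O) (O_enc : has_Qholomorphic_encoding L Q O)
  (coneO : is_cone O).

Local Notation e := (embed Q : {mpoly K[t]} -> 'rV[K]_N).
Local Notation Obar := (object_closure Q O).
Local Notation sigma := (sample (map_mx (real_complex R) gamma)).
Local Notation X := (zariski_closure ratr_K (e @` O)).

Definition basis_samples s (P : 'M[K]_(s, t)) : 'M[K]_(d, s) :=
  \matrix_(i, j) meval (fun l => P j l) (map_mpoly ratr_K (b i)).

Lemma sample_comb s (P : 'M[K]_(s, t)) c : sample P (comb b c) = c *m basis_samples P.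
Proof.
apply/rowP => j; rewrite !mxE /comb raddf_sum; apply: eq_bigr => i _ /=.
by rewrite mevalZ mxE.
Qed.

Definition rat_basis_samples : 'M[rat]_(d, N) :=
  \matrix_(i, j) meval (fun l => Q j l) (b i).

Let E : 'M[K]_(d, N) := basis_samples (map_mx ratr_K Q).

(** Rationality gives the span rational equations, which pass to the Q-closure, and keeps
    coefficients in the basis [b] algebraic over the embedded coordinates. *)
Lemma E_rational : E = map_mx ratr_K rat_basis_samples.
Proof.
apply/matrixP => i j; rewrite !mxE; elim/mpolyind: (b i) => [|c n p _ _ IH].
  by rewrite !raddf0.
rewrite (raddfD (map_mpoly _)) !mevalD rmorphD /=; congr (_ + _); last exact: IH.
rewrite map_mpolyZ map_mpolyX !mevalZ !mevalX rmorphM rmorph_prod; congr (_ * _).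
by apply: eq_bigr => l _; rewrite mxE rmorphXn.
Qed.

Lemma E_free : E *m pinvmx E = 1%:M.
Proof.
apply: mulmxVp; rewrite -kermx_eq0; apply/eqP/row_matrixP => i.
rewrite row0; apply: b_inj.
have span c : lin_span O (comb b c) by rewrite -b_span; exists c.
apply: Q_inj; [exact: mem_set|exact: mem_set|]; rewrite /embed !sample_comb -/E mul0mx.
by rewrite -row_mul mulmx_ker row0.
Qed.

Let decode (z : 'rV[K]_N) : {mpoly K[t]} := comb b (z *m pinvmx E).

Lemma embed_comb c : e (comb b c) = c *m E.
Proof. exact: sample_comb. Qed.

Lemma decode_embed F : lin_span O F -> decode (e F) = F.
Proof.
rewrite -b_span => -[c _ <-].
by rewrite /decode embed_comb -mulmxA E_free mulmx1.
Qed.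

Lemma span_sub F : O F -> lin_span O F.
Proof.
move=> OF; exists 1%N, (fun=> 1), (fun=> F); split=> //.
by rewrite big_ord1 scale1r.
Qed.

(** The row space of [E] is cut out by the rational linear forms of its cokernel; these vanish on
    the embedded [O], hence on the closure. *)
Lemma closure_in_span z : X z -> z *m pinvmx E *m E = z.
Proof.
move=> Xz; apply/mulmxKpV; rewrite submxE; apply/eqP/rowP => j.
rewrite [RHS]mxE.
pose p : {mpoly rat[N]} :=
  \sum_(i < N) cokermx rat_basis_samples i j *: mpolyX rat (mnm1 i).
have pE x : peval ratr_K p x = (x *m cokermx E) ord0 j.
  rewrite /peval /rveval E_rational -map_cokermx /p (raddf_sum (map_mpoly _)).
  rewrite (raddf_sum (meval _)) mxE; apply: eq_bigr => i _ /=.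
  by rewrite map_mpolyZ map_mpolyX mevalZ mevalXU [in RHS]mxE; exact: mulrC.
rewrite -pE; apply: zariski_closure_vanish Xz => _ [F /span_sub + <-].
rewrite -b_span => -[c _ <-].
by rewrite pE embed_comb -mulmxA mulmx_coker mulmx0 mxE.
Qed.

Lemma decode_closure z : X z -> Obar (decode z) /\ e (decode z) = z.
Proof.
move=> Xz; have ez : e (decode z) = z by rewrite embed_comb closure_in_span.
split=> //; split; first by rewrite -b_span; exists (z *m pinvmx E).
by rewrite /= ez.
Qed.

Lemma embed_Obar : e @` Obar = X.
Proof.
apply/seteqP; split=> [_ [F [_ XF] <-]//|z Xz].
by have [? ?] := decode_closure Xz; exists (decode z).
Qed.

(** The map [sigma] on affine N-space: recover the coefficients in the basis [b], then evaluate at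
    the points [gamma]. *)
Definition sigma_mx : 'M[K]_(N, m) :=
  pinvmx E *m basis_samples (map_mx (real_complex R) gamma).

Lemma sigma_embed F : lin_span O F -> sigma F = e F *m sigma_mx.
Proof.
rewrite -b_span => -[c _ <-].
by rewrite sample_comb embed_comb /sigma_mx mulmxA -(mulmxA c) E_free mulmx1.
Qed.

Lemma embed_scale a F : e (a *: F) = a *: e F.
Proof. by apply/rowP => j; rewrite !mxE mevalZ. Qed.

Lemma X_cone a x : X x -> X (a *: x).
Proof.
apply: zariski_closure_cone => c _ [F OF <-].
by exists (c *: F); [exact: coneO|rewrite embed_scale].
Qed.

Lemma sampled_closure_inj z z' : X z -> X z' ->
  z *m sigma_mx = z' *m sigma_mx -> z = z'.
Proof.
move=> Xz Xz' zz'.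
have [D [omega [[_ OD surj] [w wE]]]] := O_enc.
have Ow x : (e @` O) x -> exists y, forall j, x ord0 j = peval ratr_K (w j) y.
  move=> [F OF <-]; have [y Dy <-] := surj F OF.
  by exists y => j; rewrite -wE.
have [B1 [B1z B1i zB1]] := transcendence_basis set0 (coords z).
have [B2 [B2z B2i zB2]] := transcendence_basis set0 (coords z').
have sB1 := closure_trdeg Ow Xz B1z B1i.
have sB2 := closure_trdeg Ow Xz' B2z B2i.
(* The difference of the two objects. Its coefficients are rational combinations of the coordinates
   of [z] and [z'], so they are algebraic over [B1] and [B2]. *)
pose H := comb b ((z - z') *m pinvmx E).
suff H0 : H = 0.
  have HE : e H = z - z'.
    by rewrite embed_comb !mulmxBl !closure_in_span.
  apply/eqP; rewrite -subr_eq0 -HE H0; apply/eqP/rowP => j.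
  by rewrite !mxE meval0.
apply: (generic_separation m_gt2L sB1 sB2 gamma_generic) => [n|i].
  have zB (y : 'rV[K]_N) j : y = z \/ y = z' -> acl [set` B1 ++ B2] (y ord0 j).
    have yj : y ord0 j \in coords y by apply: map_f; rewrite mem_enum.
    case=> yz; subst y; [have := zB1 _ yj|have := zB2 _ yj]; rewrite set0U;
      by apply: acl_mono => x xB; rewrite /= mem_cat xB ?orbT.
  rewrite /H /comb raddf_sum; apply: acl_closed; apply/QfieldP/rpred_sum => i _.
  rewrite /= mcoeffZ mcoeff_map_mpoly; apply: rpredM; last exact: rpred_rat.
  rewrite mxE; apply: rpred_sum => j _; apply: rpredM.
    rewrite !mxE; apply: rpredB; apply/QfieldP/generated_gen/zB;
      by [left|right].
  by rewrite E_rational -map_pinvmx mxE; exact: rpred_rat.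
have : (sigma H) ord0 i = 0.
  rewrite /H sample_comb -mulmxA -/(sigma_mx) mulmxBl zz' subrr mxE//.
by rewrite mxE => <-; apply: meval_eq => j; rewrite mxE.
Qed.

(** The coefficients of an object in the basis [b] are linear in its embedded coordinates, which
    yields [rho]. Conversely the embedded coordinates are the values of [rho] at the rational sample
    points. *)
Lemma value_question (D : set 'rV[K]_m) (omega : 'rV[K]_m -> {mpoly K[t]}) :
  (forall x, D x -> lin_span O (omega x)) ->
  restricts_polynomial_map (idfun : {rmorphism K -> K}) D (e \o omega) <->
  answers_value_holomorphically D omega.
Proof.
move=> Domega; split=> [[w wE]|[rho rhoE]].
  pose left_coord i : {mpoly K[m + t]} := mpolyX K (mnm1 (lshift t i)).
  pose right_coord i : {mpoly K[m + t]} := mpolyX K (mnm1 (rshift m i)).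
  have leftE (x : 'rV[K]_m) (y : 'rV[K]_t) :
      \row_i rveval (left_coord i) (row_mx x y) = x.
    by apply/rowP => i; rewrite mxE /rveval mevalXU row_mxEl.
  have rightE (x : 'rV[K]_m) (y : 'rV[K]_t) :
      \row_i rveval (right_coord i) (row_mx x y) = y.
    by apply/rowP => i; rewrite mxE /rveval mevalXU row_mxEr.
  pose W j := sval (rveval_comp left_coord (w j)).
  pose B i := sval (rveval_comp right_coord (map_mpoly ratr_K (b i))).
  have WE j x y : rveval (W j) (row_mx x y) = rveval (w j) x.
    by rewrite /W; case: rveval_comp => q /= ->; rewrite leftE.
  have BE i x y : rveval (B i) (row_mx x y) = rveval (map_mpoly ratr_K (b i)) y.
    by rewrite /B; case: rveval_comp => q /= ->; rewrite rightE.
  exists (\sum_(i < d) (\sum_(j < N) pinvmx E j i *: W j) * B i) => x y Dx.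
  rewrite -(decode_embed (Domega x Dx)) /decode /comb.
  rewrite /rveval (raddf_sum (meval _)) [RHS](raddf_sum (meval _)).
  apply: eq_bigr => i _ /=; rewrite mevalM mevalZ -!/(rveval _ _) BE; congr (_ * _).
  rewrite /rveval (raddf_sum (meval _)) mxE; apply: eq_bigr => j _ /=.
  rewrite mevalZ -/(rveval _ _) WE mulrC; congr (_ * _).
  by have /= -> := wE x Dx j; rewrite peval_idfun.
have q_ex j : {q : {mpoly K[m]} | forall x, D x -> e (omega x) ord0 j = rveval q x}.
  pose pt : 'rV[K]_t := row j (map_mx ratr_K Q).
  pose W (i : 'I_(m + t)) : {mpoly K[m]} := match fintype.split i with
    inl k => mpolyX K (mnm1 k) | inr l => mpolyC m (pt ord0 l) end.
  have [q qE] := rveval_comp W rho; exists q => x Dx; rewrite qE.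
  have -> : \row_i rveval (W i) x = row_mx x pt.
    apply/rowP => i; rewrite !mxE /W; case: splitP => k _.
      by rewrite /rveval mevalXU.
    by rewrite /rveval mevalC.
  rewrite rhoE// mxE /rveval; apply: meval_eq => l.
  by rewrite !mxE.
exists (fun j => sval (q_ex j)) => x Dx j.
by rewrite peval_idfun; case: (q_ex j) => q /= ->.
Qed.

End ObjectClass.

Theorem corollary9 (R : realType) (L m t : nat) (m_gt2L : (2 * L < m)%N) :
  exists S : set 'M[R]_(m, t),
    dense S /\
    forall gamma : 'M[R]_(m, t), S gamma ->
    forall (O : set {mpoly R[i][t]}) (N : nat) (Q : 'M[rat]_(N, t)),
      Qobject_class O ->
      embeds_span Q O ->
      has_Qholomorphic_encoding L Q O ->
      is_cone O ->
      let e : {mpoly R[i][t]} -> 'rV[R[i]]_N := embed Q in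
      let Obar := object_closure Q O in
      let sigma : {mpoly R[i][t]} -> 'rV[R[i]]_m :=
        sample (map_mx (real_complex R) gamma) in
      let Dstar := sigma @` Obar in
      let omegastar := 'pinv_(fun=> 0) Obar sigma in
      let C_in_C : {rmorphism R[i] -> R[i]} := idfun in
      (is_cone Dstar /\ zariski_closed C_in_C Dstar /\ strongly_closed Dstar) /\
      (finite_morphism e Obar id Dstar sigma /\ set_bij Obar Dstar sigma) /\
      (forall C : set {mpoly R[i][t]}, irreducible_component e Obar C ->
         irreducible id (sigma @` C) /\
         zariski_closed C_in_C (sigma @` C) /\
         birational_morphism e C id (sigma @` C) sigma /\
         finite_morphism e C id (sigma @` C) sigma /\
         set_bij C (sigma @` C) sigma) /\
      (encoding C_in_C Dstar Obar omegastar /\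
       zariski_continuous id Dstar e Obar omegastar) /\
      (restricts_polynomial_map C_in_C Dstar (e \o omegastar) <->
       answers_value_holomorphically Dstar omegastar) /\
      induces_continuous_projective_encoding Dstar (e @` Obar) (e \o omegastar).
Proof.
exists (@generic_points R m t); split; first exact: dense_generic_points.
move=> gamma gamma_gen O N Q [d [b [b_inj b_span _]]] Qinj Oenc coneO.
move=> e Obar sigma Dstar omegastar C_in_C.
have Obar_span F : Obar F -> lin_span O F by case.
have e_inj F G : Obar F -> Obar G -> e F = e G -> F = G.
  by move=> /Obar_span OF /Obar_span OG; apply: Qinj; exact: mem_set.
have eO : e @` Obar = zariski_closure (ratr : {rmorphism rat -> R[i]}) (e @` O).
  exact: embed_Obar b_span.
have sigmaE F : Obar F -> sigma F = e F *m sigma_mx gamma Q b.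
  by move=> /Obar_span; exact: sigma_embed.
have Xc : zariski_closed C_in_C (e @` Obar).
  by rewrite eO; exact: zariski_closure_zclosed.
have coneX a x : (e @` Obar) x -> (e @` Obar) (a *: x).
  by rewrite eO; exact: X_cone.
have Xinj x x' : (e @` Obar) x -> (e @` Obar) x' ->
    x *m sigma_mx gamma Q b = x' *m sigma_mx gamma Q b -> x = x'.
  by rewrite eO; exact: (sampled_closure_inj m_gt2L).
(* The partial inverse has a default value off the image; on the image, injectivity of [sigma] makes
   it a true inverse. *)
have omegaK F : Obar F -> omegastar (sigma F) = F.
  move=> OF; apply: pinvKV; last exact: mem_set.
  by move=> G H /set_mem OG /set_mem OH; exact: (sigma_inj e_inj sigmaE Xinj).
have Dstar_closed : zariski_closed C_in_C Dstar.
  exact: (closed_sigma_image sigmaE Xc coneX Xinj).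
split; [split; last split|].
- move=> a _ [F OF <-]; have [G OG Ge] : (e @` Obar) (a *: e F).
    by apply: coneX; exists F.
  by exists G => //; rewrite !sigmaE// Ge scalemxAl.
- exact: Dstar_closed.
- exact: zclosed_strongly_closed.
split.
  split; first exact: (sigma_finite sigmaE Xc coneX Xinj).
  exact: (sigma_bij e_inj sigmaE Xinj).
split.
  move=> C Ccomp; have [CO irrC _] := Ccomp.
  have Cc : zariski_closed C_in_C (e @` C) by exact: component_closed Ccomp.
  split; first exact: (sigma_irreducible sigmaE).
  split; first exact: (closed_sigma_image sigmaE Xc coneX Xinj).
  split; first exact: (sigma_birational e_inj sigmaE Xc coneX Xinj).
  split; first exact: (sigma_finite sigmaE Xc coneX Xinj).
  exact: (sigma_bij e_inj sigmaE Xinj).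
split.
  split; first exact: (omega_encoding sigmaE Xc coneX Xinj).
  exact: (omega_continuous e_inj sigmaE Xc coneX Xinj).
split; last exact: (omega_projective sigmaE Xc coneX Xinj).
apply: (value_question b_inj b_span) => // _ [F OF <-].
by rewrite omegaK//; exact: Obar_span.
Qed.
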